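(* There exists a universal constant $C>0$ such that the following holds for every positive integer $n$, every $\sigma>0$ and every $\theta^*\in\mathbb{R}^n$ (not necessarily concave). Write $K=K_n$, $\mu^*=(I-P_L)\theta^*$ and $H(\theta^* )=V(\Pi_K(\mu^* ))$. (i) For every $x>0$, with probability greater than $1-\exp(-x)-\exp(-x^2/16)$, $$\frac1n\|\hat\theta-\theta^*\|^2\le\frac1n\|\Pi_{K\cap L^\perp}(\mu^* )-\mu^*\|^2+\frac1n\sigma^2(2+17x)+C\,\sigma^{8/5}\big(H(\theta^* )+\sigma\big)^{2/5}n^{-4/5}.$$ (ii) Moreover, $$R(\hat\theta,\theta^* )\le\frac1n\|\Pi_{K\cap L^\perp}(\mu^* )-\mu^*\|^2+C\,\sigma^{8/5}\big(H(\theta^* )+\sigma\big)^{2/5}n^{-4/5}+\frac{2\sigma^2}{n}.$$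
   Context: $K_n=\{\theta\in\mathbb{R}^n:\ \theta_i-\theta_{i-1}\ge\theta_{i+1}-\theta_i \text{ for all } 2\le i\le n-1\}$ is the closed convex cone of concave sequences (for $n\le 2$ the condition is vacuous and $K_n=\mathbb{R}^n$). One observes $y=\theta^*+z$, where $z=(z_1,\dots,z_n)$ has i.i.d. $N(0,\sigma^2)$ entries. $\|\cdot\|$ is the Euclidean norm on $\mathbb{R}^n$. The least squares estimator is $\hat\theta=\operatorname{argmin}_{\theta\in K_n}\|y-\theta\|^2$, and its risk is $R(\hat\theta,\theta^* )=\mathbb{E}\,\frac1n\|\hat\theta-\theta^*\|^2$, the expectation being over $y$. $L$ is the linear subspace of $\mathbb{R}^n$ spanned by $(1,\dots,1)$ and $(1,2,\dots,n)$, $L^\perp$ is its orthogonal complement, $P_L$ is the orthogonal projection matrix onto $L$, and $I$ is the identity matrix. For a closed convex cone $D\subset\mathbb{R}^n$, $\Pi_D(\theta)$ denotes the Euclidean projection of $\theta$ onto $D$. For $\theta\in\mathbb{R}^n$, $V(\theta)=\max_{1\le i\le n}\theta_i-\min_{1\le i\le n}\theta_i$. A universal constant is one that does not depend on any of the other quantities. *)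

(* Defs.v *)
From mathcomp Require Export all_boot all_order all_algebra.
From mathcomp Require Export all_classical all_reals all_analysis.
Export Order.TTheory GRing.Theory Num.Theory numFieldNormedType.Exports.

Set Implicit Arguments.
Unset Strict Implicit.
Unset Printing Implicit Defensive.

Global Open Scope classical_set_scope.
Global Open Scope ring_scope.

(* Vectors of R^n are row vectors.  Indices are shifted by one: the coordinate
   theta_i (1 <= i <= n) is theta 0 (i - 1) in 'I_n. *)

(* The norm `|v| that the library puts on matrices is the sup norm. *)
Definition enorm (R : realType) n (v : 'rV[R]_n) : R :=
  Num.sqrt (\sum_(i < n) v 0 i ^+ 2).

(* If f has no minimizer on A, [get] returns an arbitrary point; this does not
   happen below, where f is a (squared) Euclidean distance and A is a nonempty
   closed convex set, so that the minimizer exists and is unique. *)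
Definition argmin (R : realType) (T : pointedType) (A : set T) (f : T -> R) : T :=
  get [set x | A x /\ forall x', A x' -> f x <= f x'].

Definition eproj (R : realType) n (D : set 'rV[R]_n) (theta : 'rV[R]_n) :
    'rV[R]_n :=
  argmin D (fun u => enorm (theta - u)).

Definition concave_cone (R : realType) n : set 'rV[R]_n :=
  [set theta | forall i j k : 'I_n, j = i.+1 :> nat -> k = j.+1 :> nat ->
     theta 0 k - theta 0 j <= theta 0 j - theta 0 i].
Arguments concave_cone : clear implicits.

Definition lse (R : realType) n (y : 'rV[R]_n) : 'rV[R]_n :=
  argmin (concave_cone R n) (fun theta => enorm (y - theta) ^+ 2).

(* Linear subspaces of R^n are row spaces of matrices. *)
Definition affine_seqs (R : realType) n : 'M[R]_n :=
  ((const_mx 1 : 'rV[R]_n) + \row_(i < n) i.+1%:R)%MS.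
Arguments affine_seqs : clear implicits.

(* v *m A^T = 0 says that v is orthogonal to every row of A. *)
Definition orth_compl (R : realType) m n (A : 'M[R]_(m, n)) : 'M[R]_n :=
  kermx A^T.

(* Acts on row vectors by right multiplication: v |-> v *m orth_proj_mx A is the
   projection onto the row space of A along its orthogonal complement. *)
Definition orth_proj_mx (R : realType) n (A : 'M[R]_n) : 'M[R]_n :=
  proj_mx A (orth_compl A).

(* For n > 0 the set of coordinates is finite and nonempty, so that sup and inf
   are its maximum and minimum. *)
Definition variation (R : realType) n (theta : 'rV[R]_n) : R :=
  sup (range (theta 0)) - inf (range (theta 0)).

Definition mutually_independent (R : realType) (d : measure_display)
    (T : measurableType d) (P : probability T R) (I : finType)
    (X : I -> {RV P >-> R}) : Prop :=
  forall (J : {set I}) (B : I -> set R), (forall i, measurable (B i)) ->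
    P (\bigcap_(i in [set` J]) (X i @^-1` B i)) =
    (\prod_(i in J) P (X i @^-1` B i))%E.

(* The second parameter of normal_prob is the standard deviation. *)
Definition iid_centered_normal (R : realType) (d : measure_display)
    (T : measurableType d) (P : probability T R) (I : finType)
    (sigma : R) (X : I -> {RV P >-> R}) : Prop :=
  mutually_independent X /\
  forall (i : I) (B : set R), measurable B ->
    distribution P (X i) B = normal_prob 0 sigma B.

(* Main.v *)
Require Import Defs.
From mathcomp Require Import measurable_realfun ring lra zify.

(** Write K for the concave sequences and let [p] be the projection of mu onto K.
    Convexity gives the oracle inequality
      |lse - theta|^2 <= |p - mu|^2 + 2 <z, v> - |v|^2,   v = kappa - p, kappa in K,
    so it suffices to bound the exponential moment of the supremum over kappa of
    the right-hand side; both parts of the theorem follow from Markov's inequality.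

    Given kappa, cut [0, n) dyadically until, on every cell of length m, the total
    variations of the slopes of kappa and p are at most m^(-3/2) (for unit
    variance).  On such a cell v is affine up to an error of norm 1 and
    2 <z, v> - |v|^2 is controlled by two Gaussian coordinates and, after Abel
    summation, by the mean of the absolute partial sums of z.  Summing the
    exponentials over all dyadic partitions costs only the recursion
    S(cell) = leaf(cell) + S(left half) * S(right half), so no entropy numbers and
    no chaining are needed.  All exponentials are finite positive combinations of
    exp(<z, b> - |b|^2 / 2), whose expectation is 1; this is the only way in which
    the distribution of z enters.

    The number of cells is at most of order n^(1/5) (H + 1)^(2/5) + |v| log n: a
    concave sequence at distance |v| from p has slopes of order
    H / a + |v| a^(-3/2) at distance a from the end points, and these bound the
    number of cells that must be cut at each scale.  The term |v| log n is absorbed by a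
    fraction of |v|^2. *)

Set Implicit Arguments.
Unset Strict Implicit.
Unset Printing Implicit Defensive.

(** * Exponential mixtures *)

(** Vectors are sequences on [nat], so that a sum over [l, r) splits at any intermediate index
    without casts. *)
Definition dot (R : realType) (l r : nat) (g b : nat -> R) : R :=
  \sum_(l <= i < r) g i * b i.

(** Each summand is a weighted likelihood ratio of a shifted standard Gaussian vector, so [m] bounds
    the expectation of [phi] at standard normal noise. Confining the shifts to [l, r) allows
    mixtures on adjacent cells to be multiplied. *)
Definition mixture (R : realType) (n l r : nat) (m : R)
    (phi : (nat -> R) -> R) : Prop :=
  exists (I : finType) (w : I -> R) (b : I -> nat -> R),
  [/\ forall k, 0 <= w k,
      forall k i, ~~ (l <= i < r)%N -> b k i = 0,
      \sum_k w k <= m &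
      forall g, phi g =
        \sum_k w k * expR (dot 0 n g (b k) - dot 0 n (b k) (b k) / 2)].

Lemma dotDr (R : realType) l r (g a b : nat -> R) :
  dot l r g (fun i => a i + b i) = dot l r g a + dot l r g b.
Proof. by rewrite /dot -big_split; apply: eq_bigr => i _; rewrite mulrDr. Qed.

Lemma dotZr (R : realType) l r (g a : nat -> R) c :
  dot l r g (fun i => c * a i) = c * dot l r g a.
Proof. by rewrite /dot mulr_sumr; apply: eq_bigr => i _; rewrite mulrCA. Qed.

Lemma dotC (R : realType) l r (g a : nat -> R) : dot l r g a = dot l r a g.
Proof. by rewrite /dot; apply: eq_bigr => i _; rewrite mulrC. Qed.

Lemma dotDl (R : realType) l r (g a b : nat -> R) :
  dot l r (fun i => a i + b i) g = dot l r a g + dot l r b g.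
Proof. by rewrite !(dotC _ _ _ g) dotDr. Qed.

Lemma dotZl (R : realType) l r (g a : nat -> R) c :
  dot l r (fun i => c * a i) g = c * dot l r a g.
Proof. by rewrite !(dotC _ _ _ g) dotZr. Qed.

Lemma dot_ge0 (R : realType) l r (a : nat -> R) : 0 <= dot l r a a.
Proof. by rewrite /dot sumr_ge0// => i _; rewrite -expr2 sqr_ge0. Qed.

Lemma dot_cat (R : realType) l k r (g a : nat -> R) : (l <= k <= r)%N ->
  dot l r g a = dot l k g a + dot k r g a.
Proof. by move=> /andP[lk kr]; rewrite /dot (big_cat_nat _ kr). Qed.

Lemma dot_disjoint (R : realType) n l k r (a b : nat -> R) :
  (forall i, ~~ (l <= i < k)%N -> a i = 0) ->
  (forall i, ~~ (k <= i < r)%N -> b i = 0) -> dot 0 n a b = 0.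
Proof.
move=> a0 b0; rewrite /dot big1// => i _.
have [ik|ki] := ltnP i k; first by rewrite [b i]b0 ?mulr0// negb_and -ltnNge ik.
by rewrite [a i]a0 ?mul0r// negb_and -!leqNgt ki orbT.
Qed.

Lemma mixture_sub (R : realType) n l r l' r' (m m' : R) phi :
  (l' <= l)%N -> (r <= r')%N -> m <= m' ->
  mixture n l r m phi -> mixture n l' r' m' phi.
Proof.
move=> ll rr mm [I [w [b [w0 b0 wm E]]]]; exists I, w, b; split=> //.
  move=> k i lir; apply: b0; apply: contra lir => /andP[li ir].
  by rewrite (leq_trans ll li) (leq_trans ir rr).
exact: le_trans mm.
Qed.

Lemma mixture0 (R : realType) n l r : mixture n l r 0 (fun=> 0 : R).
Proof.
exists void, (fun=> 0), (fun _ _ => 0); split=> //; first by rewrite big1// => -[].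
by move=> g; rewrite big1// => -[].
Qed.

Lemma mixture_atom (R : realType) n l r (b : nat -> R) :
  (forall i, ~~ (l <= i < r)%N -> b i = 0) ->
  mixture n l r 1 (fun g => expR (dot 0 n g b - dot 0 n b b / 2)).
Proof.
move=> b0; exists unit, (fun=> 1), (fun=> b); split=> //.
  by rewrite sumr_const card_unit.
by move=> g; rewrite sumr_const card_unit mulr1n mul1r.
Qed.

Lemma mixtureD (R : realType) n l r (m1 m2 : R) phi psi :
  mixture n l r m1 phi -> mixture n l r m2 psi ->
  mixture n l r (m1 + m2) (fun g => phi g + psi g).
Proof.
move=> [I [w [b [w0 b0 wm E]]]] [I' [w' [b' [w0' b0' wm' E']]]].
exists (I + I')%type, (fun k => match k with inl i => w i | inr i => w' i end),
  (fun k => match k with inl i => b i | inr i => b' i end); split.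
- by case.
- by case.
- by rewrite big_sumType/= lerD.
- by move=> g; rewrite big_sumType/= E E'.
Qed.

Lemma mixtureZ (R : realType) n l r (m c : R) phi : 0 <= c ->
  mixture n l r m phi -> mixture n l r (c * m) (fun g => c * phi g).
Proof.
move=> c0 [I [w [b [w0 b0 wm E]]]]; exists I, (fun i => c * w i), b; split=> //.
- by move=> k; rewrite mulr_ge0.
- by rewrite -mulr_sumr ler_wpM2l.
- by move=> g; rewrite E mulr_sumr; apply: eq_bigr => i _; rewrite mulrA.
Qed.

Lemma mixture_sum (R : realType) n l r (m : nat -> R) phi a c :
  (forall k, (a <= k < c)%N -> mixture n l r (m k) (phi k)) ->
  mixture n l r (\sum_(a <= k < c) m k) (fun g => \sum_(a <= k < c) phi k g).
Proof.
have [ca|ac] := leqP c a.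
  move=> _; rewrite big_geq//.
  rewrite (_ : (fun g => _) = fun=> 0); first exact: mixture0.
  by apply/funext => g; rewrite big_geq.
elim: c ac => // c IH; rewrite ltnS => ac H.
move: ac; rewrite leq_eqVlt => /predU1P[ac|ac].
  rewrite -ac big_nat1; rewrite (_ : (fun g => _) = phi a); last first.
    by apply/funext => g; rewrite big_nat1.
  by apply: H; rewrite ac leqnn ltnS leqnn.
rewrite big_nat_recr/= 1?ltnW// (_ : (fun g => _) =
  fun g => \sum_(a <= k < c) phi k g + phi c g); last first.
  by apply/funext => g; rewrite big_nat_recr//= ltnW.
apply: mixtureD; last by apply: H; rewrite ltnSn ltnW.
by apply: IH => // k /andP[ak kc]; apply: H; rewrite ak ltnS ltnW.
Qed.

(** Shifts with disjoint supports are orthogonal, so |b + b'|^2 = |b|^2 + |b'|^2 and a product of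
    two exponentials has the same form again. This takes the place of independence between cells. *)
Lemma mixtureM (R : realType) n l k r (m1 m2 : R) phi psi :
  (l <= k <= r)%N -> mixture n l k m1 phi -> mixture n k r m2 psi ->
  mixture n l r (m1 * m2) (fun g => phi g * psi g).
Proof.
move=> /andP[lk kr] [I [w [b [w0 b0 wm E]]]] [I' [w' [b' [w0' b0' wm' E']]]].
exists (I * I')%type, (fun p => w p.1 * w' p.2), (fun p i => b p.1 i + b' p.2 i).
split.
- by move=> p; rewrite mulr_ge0.
- move=> p i lir; rewrite b0 ?b0' ?addr0//; apply: contra lir => /andP[h1 h2].
    by rewrite (leq_trans lk h1).
  by rewrite h1 (leq_trans h2 kr).
- rewrite -(pair_bigA _ (fun i j => w i * w' j))/= -big_distrlr/=.
  by rewrite ler_pM// sumr_ge0.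
- move=> g; rewrite E E' big_distrlr/= (pair_bigA _ (fun i j => _))/=.
  apply: eq_bigr => p _; rewrite mulrACA -expRD; congr (_ * expR _).
  rewrite !dotDr !dotDl [dot 0 n (b' _) (b _)]dotC (dot_disjoint _ (b0 p.1) (b0' p.2)).
  by field.
Qed.

(* For g in [k, k + 1], the exponent k g - k^2 / 2 - k is at least g^2 / 4 - 1. *)
Lemma quadratic_mixture (R : realType) (n l r N : nat) (b : nat -> R) :
  (forall i, ~~ (l <= i < r)%N -> b i = 0) -> dot 0 n b b <= 1 ->
  exists2 phi, mixture n l r (4 * expR 1) phi &
    forall g, `|dot 0 n g b| <= N%:R -> expR (dot 0 n g b ^+ 2 / 4) <= phi g.
Proof.
move=> b0 b1.
pose at_ (s : R) (k : nat) (g : nat -> R) := expR (1 - k%:R) *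
  expR (dot 0 n g (fun i => s * k%:R * b i) -
    dot 0 n (fun i => s * k%:R * b i) (fun i => s * k%:R * b i) / 2).
have mat s k : mixture n l r (expR (1 - k%:R)) (at_ s k).
  rewrite -[X in mixture _ _ _ X]mulr1; apply: mixtureZ; first exact: expR_ge0.
  by apply: mixture_atom => i /b0 ->; rewrite mulr0.
(* The cut-off N keeps the family finite. Whatever N, the mass is at most 2 e times the sum of the
   e^(-k), and that sum is at most 2. *)
exists (fun g => \sum_(0 <= k < N.+1) (at_ 1 k g + at_ (-1) k g)).
  apply: (@mixture_sub _ _ l r l r
    (\sum_(0 <= k < N.+1) (expR (1 - k%:R) + expR (1 - k%:R)))) => //.
    rewrite (_ : \sum_(0 <= k < N.+1) _ =
      (2 * expR 1) * \sum_(0 <= k < N.+1) expR (- k%:R)); last first.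
      by rewrite mulr_sumr; apply: eq_bigr => k _; rewrite expRD; ring.
    rewrite (_ : 4 * expR 1 = (2 * expR 1) * 2); last by ring.
    rewrite ler_wpM2l ?mulr_ge0 ?expR_ge0//.
    have H (M : nat) : \sum_(0 <= k < M) expR (- k%:R) <= 2 - 2 * 2^-1 ^+ M :> R.
      elim: M => [|M IH]; first by rewrite big_nil expr0; lra.
      rewrite big_nat_recr//= exprS.
      have : expR (- M%:R) <= 2^-1 ^+ M :> R.
        rewrite -mulN1r -mulrC expRM_natl lerXn2r ?nnegrE ?expR_ge0//.
        rewrite expRN lef_pV2 ?posrE ?expR_gt0//.
        by have := @expR_ge1Dx R 1; lra.
      by lra.
    apply: le_trans (H _) _.
    have : 0 <= 2^-1 ^+ N.+1 :> R by rewrite exprn_ge0.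
    by lra.
  by apply: mixture_sum => k _; exact: mixtureD.
move=> g gN.
set t := dot 0 n g b in gN *.
have atE s k : s ^+ 2 = 1 -> at_ s k g >= expR (1 - k%:R + (s * k%:R * t - k%:R ^+ 2 / 2)).
  move=> s1; rewrite expRD ler_wpM2l ?expR_ge0// ler_expR.
  have k0 : 0 <= k%:R ^+ 2 :> R by rewrite sqr_ge0.
  rewrite !dotZr dotZl -/t lerD2l mulrA -expr2 exprMn s1 mul1r.
  by nra.
have sum_ge k : (k < N.+1)%N -> at_ 1 k g + at_ (-1) k g <=
    \sum_(0 <= k < N.+1) (at_ 1 k g + at_ (-1) k g).
  move=> kN; rewrite (bigD1_seq k) ?mem_index_iota ?iota_uniq ?kN//= lerDl.
  by apply: sumr_ge0 => j _; rewrite addr_ge0// mulr_ge0// expR_ge0.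
have [k kN [k1 k2]] : exists2 k, (k < N.+1)%N & (k%:R <= `|t| /\ `|t| < k%:R + 1).
  have /Num.Theory.truncn_itv/andP[h1 h2] := normr_ge0 t.
  exists (Num.truncn `|t|); first by rewrite ltnS -(ler_nat R) (le_trans h1).
  by rewrite h1 -natr1 in h2 *.
apply: le_trans (sum_ge _ kN).
have at0 s : 0 <= at_ s k g by rewrite mulr_ge0// expR_ge0.
(* Right side minus left side is a quadratic in u with leading coefficient -1/4. It is the chord
   between its values at k and k + 1, both nonnegative, plus (u - k)(k + 1 - u) / 4. *)
have key (u : R) : k%:R <= u -> u < k%:R + 1 ->
    u ^+ 2 / 4 <= 1 - k%:R + (k%:R * u - k%:R ^+ 2 / 2).
  move=> ku uk; rewrite -subr_ge0 (_ : _ - _ =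
    (k%:R + 1 - u) * (k%:R / 2 - 1) ^+ 2 +
    (u - k%:R) * (((k%:R - 1) ^+ 2 + 2) / 4) + (u - k%:R) * (k%:R + 1 - u) / 4);
    last by field.
  have ? : 0 <= k%:R + 1 - u by lra.
  have ? : 0 <= u - k%:R by lra.
  apply: addr_ge0; last by rewrite divr_ge0// mulr_ge0.
  apply: addr_ge0; first by rewrite mulr_ge0// sqr_ge0.
  by rewrite mulr_ge0// divr_ge0// addr_ge0// sqr_ge0.
have [t0|t0] := leP 0 t.
  move: k1 k2; rewrite ger0_norm// => k1 k2.
  apply: (@le_trans _ _ (at_ 1 k g)); last by rewrite lerDl.
  apply: le_trans (atE 1 k _); last by rewrite expr1n.
  by rewrite ler_expR mul1r; exact: key.
move: k1 k2; rewrite ltr0_norm// => k1 k2.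
apply: (@le_trans _ _ (at_ (-1) k g)); last by rewrite lerDr.
apply: le_trans (atE (-1) k _); last by rewrite sqrrN expr1n.
by rewrite ler_expR -sqrrN mulN1r mulNr -mulrN; exact: key.
Qed.

(** Jensen's inequality: the tangent of exp at the mean a lies below exp, and its linear terms
    cancel on averaging. *)
Lemma expR_mean_le (R : realType) (l m : nat) (x : nat -> R) : (0 < m)%N ->
  expR (m%:R^-1 * \sum_(l <= i < l + m) x i) <=
  m%:R^-1 * \sum_(l <= i < l + m) expR (x i).
Proof.
move=> m0; set a := m%:R^-1 * _.
have m0R : 0 < m%:R :> R by rewrite ltr0n.
rewrite ler_pdivlMl//.
have -> : m%:R * expR a = \sum_(l <= i < l + m) expR a * (1 + (x i - a)).
  rewrite -mulr_sumr big_split/= sumrB !sumr_const_nat addKn.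
  have -> : \sum_(l <= i < l + m) x i = a * m%:R.
    by rewrite /a mulrC mulrA divff ?mul1r// gt_eqF.
  by rewrite -mulr_natr; ring.
apply: ler_sum => i _.
rewrite -[X in _ <= expR X](subrK a) [X in _ <= X]expRD mulrC.
by rewrite ler_wpM2r ?expR_ge0// expR_ge1Dx.
Qed.

(** Jensen's inequality moves the mean outside exp, and e^|t| <= e^t + e^(-t). The factor e on each
    atom pays for |b|^2 / 2 <= 1/2. *)
Lemma abs_mean_mixture (R : realType) (n l r k m : nat) (b : nat -> nat -> R) :
  (0 < m)%N ->
  (forall j i, ~~ (l <= i < r)%N -> b j i = 0) ->
  (forall j, dot 0 n (b j) (b j) <= 1) ->
  exists2 phi, mixture n l r (2 * expR 1) phi &
    forall g, expR (m%:R^-1 * \sum_(k <= j < k + m) `|dot 0 n g (b j)|) <= phi g.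
Proof.
move=> m0 b0 b1; have m0R : 0 < m%:R :> R by rewrite ltr0n.
pose at_ (s : R) j (g : nat -> R) := expR 1 * expR (dot 0 n g (fun i => s * b j i) -
    dot 0 n (fun i => s * b j i) (fun i => s * b j i) / 2).
have mat s j : mixture n l r (expR 1) (at_ s j).
  rewrite -[X in mixture _ _ _ X]mulr1; apply: mixtureZ; first exact: expR_ge0.
  by apply: mixture_atom => i /b0 ->; rewrite mulr0.
exists (fun g => m%:R^-1 * \sum_(k <= j < k + m) (at_ 1 j g + at_ (-1) j g)).
  rewrite (_ : 2 * expR 1 = m%:R^-1 * \sum_(k <= j < k + m) (expR 1 + expR 1)).
    apply: mixtureZ; first by rewrite invr_ge0 ltW.
    by apply: mixture_sum => j _; exact: mixtureD.
  rewrite sumr_const_nat addKn -(mulr_natl (expR 1 + expR 1)) mulrA mulVf ?mul1r ?gt_eqF//.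
  by rewrite mulr_natl mulr2n.
move=> g; apply: le_trans (expR_mean_le _ _ m0) _.
rewrite ler_pM2l ?invr_gt0//; apply: ler_sum => j _.
have atE s : s ^+ 2 = 1 -> expR (s * dot 0 n g (b j)) <= at_ s j g.
  move=> s1; rewrite /at_ -expRD ler_expR !dotZr dotZl mulrA -expr2 s1 mul1r.
  by have := b1 j; lra.
have at0 s : 0 <= at_ s j g by rewrite mulr_ge0// expR_ge0.
have [t0|t0] := leP 0 (dot 0 n g (b j)).
  apply: (@le_trans _ _ (at_ 1 j g)); last by rewrite lerDl.
  by rewrite ger0_norm//; have := atE 1; rewrite mul1r; apply; rewrite expr1n.
apply: (@le_trans _ _ (at_ (-1) j g)); last by rewrite lerDr.
by rewrite ltr0_norm//; have := atE (-1); rewrite mulN1r; apply; rewrite sqrrN expr1n.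
Qed.

Lemma dot_restrict (R : realType) n l r (g f : nat -> R) : (l <= r <= n)%N ->
  dot 0 n g (fun i => (l <= i < r)%:R * f i) = dot l r g f.
Proof.
move=> /andP[lr rn]; rewrite (@dot_cat _ 0 l n) ?(leq_trans lr)//.
rewrite (@dot_cat _ l r n) ?lr// [X in X + _]big_nat_cond big1 ?add0r; last first.
  by move=> i /andP[/andP[_ il] _]; rewrite leqNgt il mul0r mulr0.
rewrite [X in _ + X]big_nat_cond [X in _ + X]big1 ?addr0; last first.
  by move=> i /andP[/andP[ri _] _]; rewrite [(i < r)%N]ltnNge ri andbF mul0r mulr0.
by rewrite /dot big_nat_cond [RHS]big_nat_cond; apply: eq_bigr => i; rewrite andbT => ->; rewrite mul1r.
Qed.

(** Every coordinate of b is at most 1 in absolute value. The estimate provides the cut-off N of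
    [quadratic_mixture], on which the mass does not depend. *)
Lemma dot_bounded (R : realType) n G (g b : nat -> R) :
  (forall i, (i < n)%N -> `|g i| <= G%:R) -> dot 0 n b b <= 1 ->
  `|dot 0 n g b| <= (n * G)%:R.
Proof.
move=> gG b1; apply: le_trans (ler_norm_sum _ _ _) _.
apply: (@le_trans _ _ (\sum_(0 <= i < n) G%:R)); last first.
  by rewrite sumr_const_nat subn0 natrM mulr_natl.
rewrite big_nat_cond [leRHS]big_nat_cond; apply: ler_sum => i /andP[/andP[_ iN] _].
rewrite normrM -[leRHS]mulr1 ler_pM// ?gG//.
rewrite -(@expr_le1 _ 2)// real_normK ?num_real//.
apply: le_trans b1; rewrite /dot (bigD1_seq i) ?mem_index_iota ?iota_uniq//= -expr2 lerDl.
by apply: sumr_ge0 => j _; rewrite -expr2 sqr_ge0.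
Qed.

(** Summation by parts: the difference on the left is the sum over k of r (k + 1) - r k times the
    tail of g after k, and the tail after the last index is empty. *)
Lemma abel_bound (R : realType) (tau : R) (l m : nat) (g r : nat -> R) :
  (forall i, (l <= i)%N -> (i.+1 < l + m)%N -> `|r i.+1 - r i| <= tau) ->
  0 <= tau ->
  `|\sum_(l <= i < l + m) g i * r i - r l * \sum_(l <= i < l + m) g i| <=
  tau * \sum_(l <= k < l + m) `|\sum_(k.+1 <= j < l + m) g j|.
Proof.
move=> + tau0; elim: m l => [|m IH] l H.
  by rewrite addn0 !big_geq// mulr0 subrr normr0 mulr0.
rewrite addnS !(@big_ltn _ _ _ l) ?ltnS ?leq_addr//.
have {}IH := IH l.+1; rewrite addSn in IH.
set S := \sum_(l.+1 <= j < _) g j; set Q := \sum_(_ <= j < _) g j * r j.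
case: m IH H @S @Q => [|m] IH H S Q.
  by rewrite /S /Q !big_geq ?addn0// !addr0 mulrC subrr normr0 mulr_ge0.
rewrite (_ : _ - _ = (Q - r l.+1 * S) + (r l.+1 - r l) * S); last by ring.
rewrite mulrDr addrC; apply: le_trans (ler_normD _ _) _.
rewrite lerD//.
  by rewrite normrM ler_wpM2r// H// addnS ltnS addnS ltnS leq_addr.
by apply: IH => i li il; apply: H; rewrite ?[(l + m.+2)%N]addnS//; exact: ltnW.
Qed.

(* The three mixtures of [leaf_mixture] have total mass (10 / 3) e^2 after
   normalisation; exp (- leaf_cost) brings it below 1 / 4. *)
Definition leaf_cost (R : realType) : R := 40 * expR 1 ^+ 2.

(** On the cell v is an affine sequence plus a remainder r of norm at most 1. The affine part meets
    the noise through two unit vectors only, and completing squares leaves g1^2 and g2^2; r meets it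
    through its small increments, by [abel_bound]. Averaging the three exponents separates the
    exponentials. *)
Lemma leaf_mixture (R : realType) (n l m G : nat) :
  (0 < m)%N -> (l + m <= n)%N ->
  exists2 phi, mixture n l (l + m) (1 / 4 : R) phi &
  forall (g v : nat -> R) (beta : R),
  (forall i, (i < n)%N -> `|g i| <= G%:R) ->
  (forall i, (l <= i)%N -> (i.+1 < l + m)%N ->
     `|v i.+1 - v i - beta| <= (m%:R * Num.sqrt m%:R)^-1) ->
  expR ((2 * dot l (l + m) g v - 7 / 8 * dot l (l + m) v v) / 17 - leaf_cost R)
    <= phi g.
Proof.
move=> m0 lmn; have m0R : 0 < m%:R :> R by rewrite ltr0n.
have sm0 : 0 < Num.sqrt m%:R :> R by rewrite sqrtr_gt0.
have smE : Num.sqrt m%:R ^+ 2 = m%:R :> R by rewrite sqr_sqrtr// ltW.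
pose u := (l + m)%N.
have lun : (l <= u <= n)%N by rewrite leq_addr.
(* Centred on the cell, hence orthogonal to the constants. *)
pose x (i : nat) : R := i%:R - l%:R - (m%:R - 1) / 2.
pose V := dot l u x x.
have V0 : 0 <= V by exact: dot_ge0.
have sVE : Num.sqrt V ^+ 2 = V by rewrite sqr_sqrtr.
pose b1 i : R := (l <= i < u)%:R * (Num.sqrt m%:R)^-1.
pose b2 i : R := (l <= i < u)%:R * (x i / Num.sqrt V).
(* The product of the noise with [e k] is a multiple of its tail sum after k. The factor 6/17
   becomes 2/17 when the three exponents are averaged. *)
pose e k i : R := (l <= i < u)%:R * ((6 / 17) / Num.sqrt m%:R * (k < i)%N%:R).
have restr (f : nat -> R) : forall i, ~~ (l <= i < u)%N -> (l <= i < u)%:R * f i = 0.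
  by move=> i /negbTE ->; rewrite mul0r.
have dd (f : nat -> R) : dot 0 n (fun i => (l <= i < u)%:R * f i)
    (fun i => (l <= i < u)%:R * f i) = dot l u f f.
  rewrite dot_restrict// /dot big_nat_cond [RHS]big_nat_cond.
  by apply: eq_bigr => i; rewrite andbT => ->; rewrite mul1r.
have b11 : dot 0 n b1 b1 <= 1.
  rewrite dd /dot sumr_const_nat addKn -expr2 exprVn smE -[leLHS]mulr_natl divff//.
  by rewrite gt_eqF.
have b21 : dot 0 n b2 b2 <= 1.
  rewrite dd (_ : (fun i => x i / Num.sqrt V) = (fun i => (Num.sqrt V)^-1 * x i)); last first.
    by apply/funext => i; rewrite mulrC.
  rewrite dotZr dotZl -/V mulrA -expr2 exprVn sVE.
  by have [->|/mulVf ->] := eqVneq V 0; rewrite ?mulr0.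
have e1 k : dot 0 n (e k) (e k) <= 1.
  rewrite dd dotZr dotZl mulrA -expr2 exprMn exprVn smE.
  have : dot l u (fun i => (k < i)%N%:R) (fun i => (k < i)%N%:R) <= m%:R :> R.
    apply: (@le_trans _ _ (\sum_(l <= i < u) 1)); last by rewrite sumr_const_nat addKn.
    by apply: ler_sum => i _; case: (k < i)%N; rewrite ?mulr1 ?mulr0.
  move=> h; apply: (@le_trans _ _ ((6 / 17) ^+ 2 / m%:R * m%:R)).
    by rewrite ler_wpM2l// divr_ge0// ltW.
  by rewrite divfK ?gt_eqF//; lra.
have [q1 mq1 hq1] := @quadratic_mixture R n l u (n * G) b1 (restr _) b11.
have [q2 mq2 hq2] := @quadratic_mixture R n l u (n * G) b2 (restr _) b21.
have [q3 mq3 hq3] := @abs_mean_mixture R n l u l m e m0 (fun k => restr _) e1.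
pose c := expR (1 - leaf_cost R) / 3.
exists (fun g => c * (q1 g + q2 g + q3 g)).
  have := mixtureD (mixtureD mq1 mq2) mq3.
  have c0 : 0 <= c by rewrite divr_ge0 ?expR_ge0.
  move=> /(mixtureZ c0); apply: mixture_sub => //.
  rewrite /c expRD expRN.
  have E1 : 0 < expR 1 :> R by exact: expR_gt0.
  have := @expR_ge1Dx R (leaf_cost R); set L := expR (leaf_cost R) => hL.
  have L0 : 0 < L by exact: expR_gt0.
  rewrite (_ : expR 1 / L / 3 * _ = (10 / 3 * expR 1 ^+ 2) / L); last first.
    by field; rewrite gt_eqF.
  rewrite ler_pdivrMr//; move: hL; rewrite /leaf_cost; lra.
move=> g v beta gG vb.
pose tau : R := (m%:R * Num.sqrt m%:R)^-1.
have tau0 : 0 <= tau by rewrite invr_ge0 mulr_ge0 ?ltW.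
have mtau : m%:R * tau = (Num.sqrt m%:R)^-1.
  by rewrite /tau invfM mulrA divff ?mul1r// gt_eqF.
pose r i := v i - v l - beta * (i%:R - l%:R).
pose al := v l + beta * ((m%:R - 1) / 2).
have vE : v = fun i => (al * 1 + beta * x i) + r i.
  by apply/funext => i; rewrite /al /r /x; ring.
have rS i : (l <= i)%N -> (i.+1 < l + m)%N -> `|r i.+1 - r i| <= tau.
  move=> li iu; rewrite (_ : _ - _ = v i.+1 - v i - beta) ?vb//.
  by rewrite /r -natr1; ring.
(* [r] vanishes at l and moves by at most [tau] at each step, so it stays below m tau = m^(-1/2). *)
have rk k : (l + k < u)%N -> `|r (l + k)%N| <= k%:R * tau.
  elim: k => [|k IH] ku; first by rewrite /r addn0 !subrr mulr0 subrr normr0 mul0r.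
  rewrite addnS in ku *.
  rewrite -(subrK (r (l + k)%N) (r _)) (le_trans (ler_normD _ _))//.
  rewrite -natr1 mulrDl mul1r addrC lerD ?IH ?rS ?leq_addr//.
  exact: ltnW.
have rr1 : dot l u r r <= 1.
  apply: (@le_trans _ _ (\sum_(l <= i < u) m%:R^-1)); last first.
    by rewrite sumr_const_nat addKn -[leLHS]mulr_natl divff// gt_eqF.
  rewrite /dot big_nat_cond [leRHS]big_nat_cond; apply: ler_sum => i.
  rewrite andbT => /andP[li iu]; rewrite -smE -exprVn -mtau -expr2.
  rewrite -[leLHS]real_normK ?num_real// lerXn2r ?nnegrE ?mulr_ge0//.
  move: iu; rewrite -(subnKC li) => iu; apply: le_trans (rk _ iu) _.
  by rewrite ler_wpM2r// ler_nat; move: iu; rewrite ltn_add2l => /ltnW.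
have xsum : \sum_(l <= i < u) x i = 0.
  have H k : \sum_(l <= i < l + k) x i = k%:R * (k%:R - 1) / 2 - k%:R * ((m%:R - 1) / 2).
    elim: k => [|k IH]; first by rewrite addn0 big_geq// mul0r; ring.
    by rewrite addnS big_nat_recr ?leq_addr//= IH /x natrD -natr1; field.
  by rewrite /u H; field.
set S := \sum_(l <= i < u) g i.
have gvE : dot l u g v = al * S + beta * dot l u g x + dot l u g r.
  rewrite vE dotDr dotDr dotZr dotZr; congr (al * _ + _ + _).
  by apply: eq_bigr => i _; rewrite mulr1.
have llE : dot l u (fun i => al * 1 + beta * x i) (fun i => al * 1 + beta * x i) =
    m%:R * al ^+ 2 + beta ^+ 2 * V.
  rewrite !dotDr !dotDl !dotZr !dotZl -/V.
  have -> : dot l u (fun=> 1) x = 0 by rewrite -[RHS]xsum; apply: eq_bigr => i _; rewrite mul1r.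
  have -> : dot l u x (fun=> 1) = 0 by rewrite -[RHS]xsum; apply: eq_bigr => i _; rewrite mulr1.
  have -> : dot l u (fun=> 1) (fun=> 1) = m%:R :> R.
    by rewrite /dot sumr_const_nat addKn mulr1.
  by ring.
(* This is a^2 / 7 + 2 a r + 7 r^2 >= 0. As 7/8 times 6/7 is 3/4, three quarters of the squared norm
   of the affine part remain. *)
have vv : 6 / 7 * (m%:R * al ^+ 2 + beta ^+ 2 * V) - 6 * dot l u r r <= dot l u v v.
  rewrite -llE /dot !mulr_sumr -sumrB; apply: ler_sum => i _.
  rewrite vE; set a := al * 1 + _; rewrite -subr_ge0.
  rewrite (_ : _ - _ = (a + 7 * r i) ^+ 2 / 7); last by field.
  by rewrite divr_ge0// sqr_ge0.
set g1 := dot 0 n g b1; set g2 := dot 0 n g b2.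
have g1E : S = Num.sqrt m%:R * g1.
  rewrite /g1 dot_restrict// /dot -mulr_suml mulrCA divff ?mulr1// gt_eqF//.
have g2E : dot l u g x = Num.sqrt V * g2.
  rewrite /g2 dot_restrict// -dotZr /dot.
  (* V = 0 occurs for m = 1; then [b2] is 0 because division by 0 gives 0, and x vanishes on the
     cell. *)
  have [V00|V00] := eqVneq V 0; last first.
    apply: eq_bigr => i _; congr (_ * _).
    by rewrite [RHS]mulrC divfK// sqrtr_eq0 -ltNge lt_def V00.
  apply: eq_big_nat => i /andP[li iu]; rewrite V00 sqrtr0 mul0r mulr0.
  have : x i ^+ 2 <= V.
    rewrite /V /dot (bigD1_seq i) ?mem_index_iota ?iota_uniq ?li//= -expr2 lerDl.
    by apply: sumr_ge0 => j _; rewrite -expr2 sqr_ge0.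
  rewrite V00 -[_ <= 0]andbT -(sqr_ge0 (x i)) -eq_le sqrf_eq0 => /eqP ->.
  by rewrite mulr0.
pose Y := \sum_(l <= k < l + m) `|\sum_(k.+1 <= j < l + m) g j|.
have grY : dot l u g r <= tau * Y.
  have := abel_bound g rS tau0; rewrite /r subrr subrr mulr0 subrr mul0r subr0.
  by apply: le_trans; exact: ler_norm.
have YE : m%:R^-1 * \sum_(l <= k < l + m) `|dot 0 n g (e k)| = 6 / 17 * (tau * Y).
  rewrite (_ : 6 / 17 * (tau * Y) = m%:R^-1 * (6 / 17 / Num.sqrt m%:R * Y)); last first.
    by rewrite /tau invfM; ring.
  congr (_ * _); rewrite /Y mulr_sumr; apply: eq_big_nat => k /andP[lk ku].
  rewrite dot_restrict// dotZr normrM ger0_norm ?divr_ge0//.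
  congr (_ * `|_|); rewrite /dot (@big_cat_nat _ _ _ k.+1)//=; last exact: leqW.
  rewrite big_nat_cond big1 ?add0r; last first.
    by move=> i /andP[/andP[_ ik] _]; rewrite ltnNge -ltnS ik mulr0.
  by apply: eq_big_nat => i /andP[-> _]; rewrite mulr1.
have Q1 := hq1 g (dot_bounded gG b11).
have Q2 := hq2 g (dot_bounded gG b21).
have Q3 := hq3 g.
apply: (@le_trans _ _ (c * (expR (g1 ^+ 2 / 4) + expR (g2 ^+ 2 / 4) + expR (6 / 17 * (tau * Y))))); last first.
  rewrite ler_wpM2l ?divr_ge0 ?expR_ge0//.
  by rewrite -YE !lerD.
pose ave (k : nat) : R := match k with 0%N => g1 ^+ 2 / 4 | 1%N => g2 ^+ 2 / 4 | _ => 6 / 17 * (tau * Y) end.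
have := @expR_mean_le R 0 3 ave isT.
rewrite add0n !big_nat_recr//= !big_nil !add0r => H3.
rewrite /c; apply: (@le_trans _ _ (expR (1 - leaf_cost R) *
  expR (3^-1 * (g1 ^+ 2 / 4 + g2 ^+ 2 / 4 + 6 / 17 * (tau * Y))))); last first.
  by rewrite -[leRHS]mulrA ler_wpM2l ?expR_ge0.
rewrite -expRD ler_expR gvE g1E g2E.
(* Times 4/3, the first square gives 2 al sqrt(m) g1 - 3/4 m al^2 <= 4/3 g1^2, and the second its
   analogue for beta. After division by 17 the coefficient 4/3 is below the available 1/12, and the
   cost 21/4 of the remainder is below 1. *)
have sq1 : 0 <= (Num.sqrt m%:R * al * 3 / 4 - g1) ^+ 2 by rewrite sqr_ge0.
have sq2 : 0 <= (Num.sqrt V * beta * 3 / 4 - g2) ^+ 2 by rewrite sqr_ge0.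
have g10 : 0 <= g1 ^+ 2 by rewrite sqr_ge0.
have g20 : 0 <= g2 ^+ 2 by rewrite sqr_ge0.
have e1' : (Num.sqrt m%:R * al * 3 / 4 - g1) ^+ 2 =
  9 / 16 * (m%:R * al ^+ 2) - 3 / 2 * (al * (Num.sqrt m%:R * g1)) + g1 ^+ 2.
  by rewrite -[X in X * al ^+ 2]smE; field.
have e2' : (Num.sqrt V * beta * 3 / 4 - g2) ^+ 2 =
  9 / 16 * (beta ^+ 2 * V) - 3 / 2 * (beta * (Num.sqrt V * g2)) + g2 ^+ 2.
  by rewrite -[X in beta ^+ 2 * X]sVE; field.
rewrite e1' in sq1; rewrite e2' in sq2.
by lra.
Qed.

(** * Dyadic partitions *)

Lemma mixture_ge0 (R : realType) n l r (m : R) phi g :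
  mixture n l r m phi -> 0 <= phi g.
Proof.
by move=> [I [w [b [w0 _ _ ->]]]]; apply: sumr_ge0 => k _; rewrite mulr_ge0// expR_ge0.
Qed.

Lemma mixture_const (R : realType) n l r (c : R) : 0 <= c ->
  mixture n l r c (fun=> c).
Proof.
move=> c0; have := mixtureZ c0 (@mixture_atom R n l r (fun=> 0) (fun _ _ => erefl)).
have d0 (f : nat -> R) : dot 0 n f (fun=> 0) = 0.
  by rewrite /dot big1// => i _; rewrite mulr0.
rewrite mulr1; congr mixture; apply/funext => g.
by rewrite !d0 mul0r subrr expR0 mulr1.
Qed.

(* Cell (j, p) is [p 2^j, (p + 1) 2^j).  A nonempty cell that sticks out of
   [0, n) never qualifies, so it is always cut. *)
Definition nearly_affine (R : realType) (n : nat) (v : nat -> R) (j p : nat) :=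
  (n <= p * 2 ^ j)%N \/
  ((p.+1 * 2 ^ j <= n)%N /\ exists beta, forall i,
     (p * 2 ^ j <= i)%N -> (i.+1 < p.+1 * 2 ^ j)%N ->
     `|v i.+1 - v i - beta| <= ((2 ^ j)%:R * Num.sqrt (2 ^ j)%:R)^-1).

(** A cell that is not inside [0, n) is nearly affine only if it lies entirely beyond n. There v =
    0, and the constant exp (- [leaf_cost]) <= 1/4 suffices. *)
Lemma nearly_affine_mixture (R : realType) (n G j p : nat) :
  exists2 phi, mixture n (p * 2 ^ j) (p.+1 * 2 ^ j) (1 / 4 : R) phi &
  forall g v : nat -> R,
  (forall i, (i < n)%N -> `|g i| <= G%:R) ->
  (forall i, (n <= i)%N -> v i = 0) -> nearly_affine n v j p ->
  expR ((2 * dot (p * 2 ^ j) (p.+1 * 2 ^ j) g v -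
         7 / 8 * dot (p * 2 ^ j) (p.+1 * 2 ^ j) v v) / 17 - leaf_cost R) <= phi g.
Proof.
have uE : (p.+1 * 2 ^ j = p * 2 ^ j + 2 ^ j)%N by rewrite mulSn addnC.
have [un|nu] := leqP (p.+1 * 2 ^ j) n.
  have [phi mphi H] := @leaf_mixture R n (p * 2 ^ j) (2 ^ j) G
    (expn_gt0 2 j) (leq_trans (eq_leq (esym uE)) un).
  rewrite uE; exists phi => // g v gG v0 [nl|[_ [beta vb]]].
    have : (p.+1 * 2 ^ j <= p * 2 ^ j)%N by exact: leq_trans nl.
    by rewrite uE -[leqRHS]addn0 leq_add2l leqNgt expn_gt0.
  by apply: (H g v beta gG) => i li iu; apply: vb; rewrite ?uE.
exists (fun=> expR (- leaf_cost R)).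
  apply: mixture_sub (leqnn _) (leqnn _) _ (mixture_const n _ _ (expR_ge0 _)).
  have := @expR_ge1Dx R (leaf_cost R); rewrite mul1r expRN => hL.
  rewrite lef_pV2 ?posrE ?expR_gt0//.
  apply: le_trans hL; rewrite /leaf_cost.
  have := @expR_ge1Dx R 1; set E := expR 1 => h.
  have : 2 * 2 <= E ^+ 2 by rewrite expr2 ler_pM//; lra.
  by lra.
move=> g v gG v0 [nl|[un _]]; last by rewrite leqNgt nu in un.
have dot0 (f : nat -> R) : dot (p * 2 ^ j) (p.+1 * 2 ^ j) f v = 0.
  rewrite /dot big_nat_cond big1// => i /andP[/andP[li _] _].
  by rewrite v0 ?mulr0// (leq_trans nl).
by rewrite !dot0 !mulr0 subrr mul0r add0r.
Qed.

Fixpoint leaves (internal : nat -> nat -> bool) (j p : nat) : nat :=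
  if j is j'.+1 then
    if internal j p then leaves internal j' p.*2 + leaves internal j' p.*2.+1
    else 1
  else 1.

Lemma nearly_affine0 (R : realType) n (v : nat -> R) p : nearly_affine n v 0 p.
Proof.
have [np|pn] := leqP n p; first by left; rewrite expn0 muln1.
right; rewrite expn0 !muln1; split=> //; exists 0 => i pi ip.
by move: (leq_ltn_trans pi (ltn_trans (ltnSn _) ip)); move: ip pi; rewrite ltnS; case: ltngtP.
Qed.

(* Summing over all dyadic partitions of the cell gives the recursion
   S(cell) = leaf(cell) + S(left) * S(right), and leaf mass 1/4 keeps the mass
   of S below its fixed point 1/2. *)
Lemma tree_mixture (R : realType) (n G j p : nat) :
  exists2 phi, mixture n (p * 2 ^ j) (p.+1 * 2 ^ j) (1 / 2 : R) phi &
  forall (g v : nat -> R) (internal : nat -> nat -> bool),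
  (forall i, (i < n)%N -> `|g i| <= G%:R) ->
  (forall i, (n <= i)%N -> v i = 0) ->
  (forall k q, ~~ internal k.+1 q -> nearly_affine n v k.+1 q) ->
  expR ((2 * dot (p * 2 ^ j) (p.+1 * 2 ^ j) g v -
         7 / 8 * dot (p * 2 ^ j) (p.+1 * 2 ^ j) v v) / 17 -
        leaf_cost R * (leaves internal j p)%:R) <= phi g.
Proof.
elim: j p => [|j IH] p.
  have [phi mphi H] := nearly_affine_mixture R n G 0 p.
  exists phi; first by apply: mixture_sub mphi => //; lra.
  by move=> g v internal gG v0 _; rewrite mulr1; apply: H => //; exact: nearly_affine0.
have [phi mphi H] := nearly_affine_mixture R n G j.+1 p.
have [phi1 mphi1 H1] := IH p.*2; have [phi2 mphi2 H2] := IH p.*2.+1.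
have eqs : [/\ (p.*2 * 2 ^ j = p * 2 ^ j.+1)%N & (p.*2.+2 * 2 ^ j = p.+1 * 2 ^ j.+1)%N].
  by rewrite expnS !mulnA !muln2.
have [eq1 eq2] := eqs.
have le_mid : (p.*2 * 2 ^ j <= p.*2.+1 * 2 ^ j <= p.*2.+2 * 2 ^ j)%N.
  by rewrite !leq_mul2r !leqnSn !orbT.
(* The first term serves a cell that is kept, the product one that is cut, so a single function
   works for every choice of [internal]. *)
exists (fun g => phi g + phi1 g * phi2 g).
  rewrite -eq1 -eq2 in mphi *.
  have := mixtureD mphi (mixtureM le_mid mphi1 mphi2).
  by apply: mixture_sub => //; lra.
move=> g v internal gG v0 hint.
have p0 : 0 <= phi g := mixture_ge0 _ mphi.
have p1 : 0 <= phi1 g := mixture_ge0 _ mphi1.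
have p2 : 0 <= phi2 g := mixture_ge0 _ mphi2.
rewrite /=; case: ifPn => hj; last first.
  rewrite mulr1 (@le_trans _ _ (phi g))//; first exact: H gG v0 (hint _ _ hj).
  by rewrite lerDl mulr_ge0.
apply: (@le_trans _ _ (phi1 g * phi2 g)); last by rewrite lerDr.
apply: le_trans (ler_pM (expR_ge0 _) (expR_ge0 _)
  (H1 g v internal gG v0 hint) (H2 g v internal gG v0 hint)).
rewrite -expRD ler_expR -eq1 -eq2 !(dot_cat _ _ le_mid) natrD.
by lra.
Qed.

(** * Slopes of concave sequences *)

Definition slope (R : realType) (f : nat -> R) (i : nat) : R := f i.+1 - f i.

Definition concave_upto (R : realType) (n : nat) (f : nat -> R) : Prop :=
  forall i, (i.+2 < n)%N -> slope f i.+1 <= slope f i.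

Lemma slope_nonincreasing (R : realType) n (f : nat -> R) i j :
  concave_upto n f -> (i <= j)%N -> (j.+1 < n)%N -> slope f j <= slope f i.
Proof.
move=> cf; elim: j => [|j IH]; first by rewrite leqn0 => /eqP ->.
rewrite leq_eqVlt => /predU1P[->//|]; rewrite ltnS => ij jn.
by apply: le_trans (IH ij (ltnW jn)); exact: cf.
Qed.

Lemma concave_upto_rev (R : realType) n (f : nat -> R) :
  concave_upto n f -> concave_upto n (fun i => f (n - i.+1)%N).
Proof.
move=> cf i ni; have := cf (n - i.+3)%N.
rewrite /slope (_ : (n - i.+3).+1 = n - i.+2)%N; last by lia.
rewrite (_ : (n - i.+2).+1 = n - i.+1)%N; last by lia.
by move=> /(_ ltac:(lia)); lra.
Qed.

(* The averages of f over [0, a) and [a, 2 a) differ by at least a times the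
   slope at b, whereas f is within t of nu in Euclidean norm. *)
Lemma slope_le (R : realType) n a b (f nu v : nat -> R) (H t : R) :
  concave_upto n f -> (0 < a)%N -> (2 * a <= b)%N -> (b.+1 < n)%N ->
  (forall i, (i < n)%N -> f i = nu i + v i) ->
  (forall i k, (i < n)%N -> (k < n)%N -> nu i - nu k <= H) ->
  0 < t -> dot 0 n v v <= t ^+ 2 ->
  slope f b <= H / a%:R + 3 / 2 * t / (a%:R * Num.sqrt a%:R).
Proof.
move=> cf a0 ab bn fE nuH t0 vt.
have a0R : 0 < a%:R :> R by rewrite ltr0n.
have sa0 : 0 < Num.sqrt a%:R :> R by rewrite sqrtr_gt0.
have saE : Num.sqrt a%:R ^+ 2 = a%:R :> R by rewrite sqr_sqrtr// ltW.
have lower : a%:R * (a%:R * slope f b) <= \sum_(0 <= j < a) (f (j + a)%N - f j).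
  rewrite (_ : a%:R * _ = \sum_(0 <= j < a) (a%:R * slope f b)); last first.
    by rewrite sumr_const_nat subn0 mulr_natl.
  rewrite big_nat_cond [leRHS]big_nat_cond; apply: ler_sum => j /andP[/andP[_ ja] _].
  rewrite -(telescope_sumr f (leq_addr a j)) (_ : a%:R * _ =
    \sum_(j <= i < j + a) slope f b); last by rewrite sumr_const_nat addKn mulr_natl.
  rewrite big_nat_cond [leRHS]big_nat_cond; apply: ler_sum => i /andP[/andP[_ ija] _].
  by apply: slope_nonincreasing cf _ bn; lia.
have vsum : \sum_(0 <= j < a) (v (j + a)%N - v j) <= 3 / 2 * t * Num.sqrt a%:R.
  (* Balances |x| <= lam / 2 + x^2 / (2 lam) over 2 a points: the two sums become t sqrt(a) and at
     most t sqrt(a) / 2. *)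
  pose lam := t / Num.sqrt a%:R.
  have lam0 : 0 < lam by rewrite divr_gt0.
  have amgm x : `|x| <= lam / 2 + x ^+ 2 / (2 * lam).
    rewrite -subr_ge0 (_ : _ - _ = (lam - `|x|) ^+ 2 / (2 * lam)).
      by rewrite divr_ge0 ?sqr_ge0 ?mulr_ge0// ltW.
    by rewrite -(real_normK (num_real x)); field; rewrite gt_eqF.
  apply: (@le_trans _ _ (\sum_(0 <= j < 2 * a) (lam / 2 + v j ^+ 2 / (2 * lam)))).
    rewrite mul2n -addnn [leRHS](@big_cat_nat _ _ _ a 0)//= ?leq_addr//.
    rewrite [X in _ <= _ + X](_ : _ =
      \sum_(0 <= j < a) (lam / 2 + v (j + a)%N ^+ 2 / (2 * lam))); last first.
      by rewrite -{1}[a]add0n big_addn addnK.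
    rewrite -big_split/=; apply: ler_sum => j _.
    have := amgm (v j); have := amgm (v (j + a)%N).
    have := ler_norm (v (j + a)%N); have := ler_norm (- v j); rewrite normrN; lra.
  rewrite big_split/= sumr_const_nat subn0 -mulr_suml.
  have : \sum_(0 <= j < 2 * a) v j ^+ 2 <= t ^+ 2.
    apply: le_trans vt; rewrite (@dot_cat _ 0 (2 * a) n); last by lia.
    rewrite (_ : dot 0 _ v v = \sum_(0 <= j < 2 * a) v j ^+ 2).
      by rewrite lerDl dot_ge0.
    by apply: eq_bigr => i _; rewrite expr2.
  move=> h; rewrite -[X in X + _]mulr_natl natrM.
  have : (\sum_(0 <= j < 2 * a) v j ^+ 2) / (2 * lam) <= t ^+ 2 / (2 * lam).
    by rewrite ler_pM2r// invr_gt0 mulr_gt0.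
  have -> : t ^+ 2 / (2 * lam) = t * Num.sqrt a%:R / 2.
    by rewrite /lam; field; rewrite !gt_eqF.
  have -> : 2 * a%:R * (lam / 2) = t * Num.sqrt a%:R.
    by rewrite /lam -[X in 2 * X]saE; field; rewrite gt_eqF.
  by lra.
have nusum : \sum_(0 <= j < a) (nu (j + a)%N - nu j) <= a%:R * H.
  rewrite (_ : a%:R * H = \sum_(0 <= j < a) H); last first.
    by rewrite sumr_const_nat subn0 mulr_natl.
  rewrite big_nat_cond [leRHS]big_nat_cond; apply: ler_sum => j /andP[/andP[_ ja] _].
  by apply: nuH; lia.
have upper : \sum_(0 <= j < a) (f (j + a)%N - f j) =
    \sum_(0 <= j < a) (nu (j + a)%N - nu j) + \sum_(0 <= j < a) (v (j + a)%N - v j).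
  rewrite -big_split/=; apply: eq_big_nat => j /andP[_ ja].
  by rewrite !fE; [ring|lia..].
have : a%:R * (a%:R * slope f b) <= a%:R * H + 3 / 2 * t * Num.sqrt a%:R by lra.
rewrite mulrA mulrC -ler_pdivlMr ?mulr_gt0//; move=> /le_trans; apply.
rewrite le_eqVlt; apply/orP; left; apply/eqP; move: sa0 saE; set s := Num.sqrt _ => sa0 <-.
by field; rewrite gt_eqF.
Qed.

(** Reversing the order of the indices turns the slope at b into minus the slope at n - b - 2, which
    reduces the claim to [slope_le]. *)
Lemma slope_ge (R : realType) n a b (f nu v : nat -> R) (H t : R) :
  concave_upto n f -> (0 < a)%N -> (2 * a + b.+1 < n)%N ->
  (forall i, (i < n)%N -> f i = nu i + v i) ->
  (forall i k, (i < n)%N -> (k < n)%N -> nu i - nu k <= H) ->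
  0 < t -> dot 0 n v v <= t ^+ 2 ->
  - (H / a%:R + 3 / 2 * t / (a%:R * Num.sqrt a%:R)) <= slope f b.
Proof.
move=> cf a0 abn fE nuH t0 vt.
have := @slope_le R n a (n - b.+2) (fun i => f (n - i.+1)%N)
  (fun i => nu (n - i.+1)%N) (fun i => v (n - i.+1)%N) H t.
rewrite /slope (_ : (n - (n - b.+2).+2)%N = b); last by lia.
rewrite (_ : (n - (n - b.+2).+1)%N = b.+1); last by lia.
move=> /(_ (concave_upto_rev cf) a0 _ _ _ _ t0) h; rewrite lerNl opprB; apply: h.
- by lia.
- by lia.
- by move=> i ni; apply: fE; lia.
- by move=> i k ni nk; apply: nuH; lia.
- apply: le_trans vt; rewrite /dot [leRHS]big_nat_rev/= add0n.
  by rewrite le_eqVlt eqxx.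
Qed.

Lemma sum_window_le (R : realType) (N a b : nat) (y : nat -> R) :
  (forall q, (a <= q < b)%N -> 0 <= y q) ->
  \sum_(0 <= q < N) (a <= q < b)%:R * y q <= \sum_(a <= q < b) y q.
Proof.
move=> y0; have [ba|ab] := leqP b a.
  rewrite [leRHS]big_geq// big1// => q _.
  rewrite (_ : (a <= q < b)%N = false) ?mul0r//.
  by apply/negP => /andP[aq qb]; have := leq_ltn_trans aq qb; rewrite ltnNge ba.
have <- : \sum_(0 <= i < maxn N b) (a <= i < b)%:R * y i = \sum_(a <= i < b) y i.
  have := @dot_restrict R (maxn N b) a b (fun=> 1) y.
  rewrite (ltnW ab) leq_maxr => /(_ isT); rewrite /dot => E.
  rewrite [RHS](eq_bigr (fun i => 1 * y i)); last by move=> i _; rewrite mul1r.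
  by rewrite -E; apply: eq_bigr => i _; rewrite mul1r.
rewrite [leRHS](@big_cat_nat _ _ _ N)//= ?leq_maxl// lerDl.
apply: sumr_ge0 => q _; case: (boolP (a <= q < b)%N) => h; last by rewrite mul0r.
by rewrite mul1r y0.
Qed.

Lemma sum_window1_le (R : realType) (N a b : nat) :
  \sum_(0 <= q < N) (a <= q < b)%:R <= (b - a)%:R :> R.
Proof.
have := @sum_window_le R N a b (fun=> 1) (fun _ _ => ler01).
rewrite sumr_const_nat; apply: le_trans; apply: ler_sum => q _.
by rewrite mulr1.
Qed.

(** Slopes of a concave sequence decrease, so their total variation inside the cell is the first
    minus the last; the last increment inside a cell starts two below its right end. *)
Definition bent (R : realType) (f : nat -> R) (j q : nat) : bool :=
  ((2 ^ j)%:R * Num.sqrt (2 ^ j)%:R)^-1 <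
  slope f (q * 2 ^ j) - slope f (q.+1 * 2 ^ j - 2).

(** A cell that straddles n is always cut, since [nearly_affine] fails there by definition. *)
Definition internal (R : realType) (n : nat) (f nu : nat -> R) (j q : nat) : bool :=
  (q * 2 ^ j < n)%N &&
  [|| (n < q.+1 * 2 ^ j)%N, bent f j q | bent nu j q].

(** Inside the cell the slopes of f and nu both fall from their initial values by an amount in
    [0, tau], tau = m^(-3/2), so their difference moves by at most tau. *)
Lemma internalPn (R : realType) n (f nu v : nat -> R) j q :
  concave_upto n f -> concave_upto n nu ->
  (forall i, (i < n)%N -> f i = nu i + v i) ->
  ~~ internal n f nu j q -> nearly_affine n v j q.
Proof.
move=> cf cnu fE; rewrite negb_and -leqNgt => /orP[|]; first by left.
rewrite !negb_or -leqNgt -!leNgt => /and3P[un bf bnu]; right; split=> //.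
exists (slope f (q * 2 ^ j) - slope nu (q * 2 ^ j)) => i li iu.
have qS : (q.+1 * 2 ^ j = q * 2 ^ j + 2 ^ j)%N by rewrite mulSn addnC.
have fi : slope f i <= slope f (q * 2 ^ j).
  by apply: slope_nonincreasing cf _ _ => //; lia.
have nui : slope nu i <= slope nu (q * 2 ^ j).
  by apply: slope_nonincreasing cnu _ _ => //; lia.
have fi' : slope f (q.+1 * 2 ^ j - 2) <= slope f i.
  by apply: slope_nonincreasing cf _ _ => //; lia.
have nui' : slope nu (q.+1 * 2 ^ j - 2) <= slope nu i.
  by apply: slope_nonincreasing cnu _ _ => //; lia.
have -> : v i.+1 - v i = slope f i - slope nu i.
  by rewrite /slope !fE; [ring|lia..].
by rewrite ler_norml; apply/andP; split; lra.
Qed.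

(** The trivial count of the cells that start in [0, n); it is the better bound at coarse scales. *)
Lemma internal_count_all (R : realType) n (f nu : nat -> R) j N :
  \sum_(0 <= q < N) (internal n f nu j q)%:R <= n%:R / (2 ^ j)%:R + 1 :> R.
Proof.
have m0 : (0 < 2 ^ j)%N by rewrite expn_gt0.
apply: (@le_trans _ _ (\sum_(0 <= q < N) (0 <= q < (n %/ 2 ^ j).+1)%:R)).
  apply: ler_sum => q _; rewrite ler_nat /internal.
  case: ltnP => //= qn; rewrite ltnS leq_divRL// (ltnW qn).
  by case: (_ || _).
apply: le_trans (sum_window1_le _ _ _ _) _.
rewrite subn0 -natr1 lerD2r ler_pdivlMr ?ltr0n// -natrM ler_nat.
exact: leq_divM.
Qed.

(** About 2 P cells at either end are counted in full. Between them [slope_le] and [slope_ge], with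
    a = P m, bound the total fall of the slopes of f and of nu by 2 K each, and every bent cell uses
    up m^(-3/2) of one of these falls. *)
Lemma internal_count_cut (R : realType) n (f nu v : nat -> R) (H t : R) j N P :
  concave_upto n f -> concave_upto n nu ->
  (forall i, (i < n)%N -> f i = nu i + v i) ->
  (forall i k, (i < n)%N -> (k < n)%N -> nu i - nu k <= H) ->
  0 <= H -> 0 < t -> dot 0 n v v <= t ^+ 2 -> (0 < P)%N -> (0 < j)%N ->
  \sum_(0 <= q < N) (internal n f nu j q)%:R <=
    4 * P%:R + 2 + 4 * (Num.sqrt (2 ^ j)%:R * H) / P%:R + 6 * t.
Proof.
move=> cf cnu fE nuH H0 t0 vt P0 j0.
set m := (2 ^ j)%N; have m2 : (2 <= m)%N by rewrite /m -(prednK j0) expnS leq_pmulr// expn_gt0.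
have m0 : (0 < m)%N by exact: leq_trans m2.
have m0R : 0 < m%:R :> R by rewrite ltr0n.
have P0R : 0 < P%:R :> R by rewrite ltr0n.
have sm0 : 0 < Num.sqrt m%:R :> R by rewrite sqrtr_gt0.
(* M full cells fit in [0, n). One cell more than 2 P is dropped on the right, which leaves room for
   the strict inequality that [slope_ge] asks for at q1 m. *)
pose M := (n %/ m)%N; pose q1 := (M - (2 * P + 1))%N.
have MP q : (q < q1)%N -> ((q.+2 + 2 * P) * m <= n)%N.
  by move=> qq; rewrite -leq_divRL// -/M; rewrite /q1 in qq; lia.
(* Measured to the start of the next cell, the falls telescope, and they dominate the falls inside
   the cells. *)
pose D (h : nat -> R) q := slope h (q * m)%N - slope h (q.+1 * m)%N.
have D0 h q : concave_upto n h -> (2 * P <= q < q1)%N -> 0 <= D h q.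
  move=> ch /andP[_ qq]; rewrite subr_ge0; apply: slope_nonincreasing ch _ _.
    by rewrite leq_mul2r leqnSn orbT.
  by have := MP _ qq; rewrite !mulSn mulnDl; lia.
have bentD h q : concave_upto n h -> (2 * P <= q < q1)%N -> bent h j q ->
    1 <= D h q * (m%:R * Num.sqrt m%:R).
  move=> ch /andP[_ qq]; rewrite /bent -/m => hb.
  rewrite -ler_pdivrMr ?mulr_gt0// mul1r (le_trans (ltW hb))// lerD2l lerN2.
  by apply: slope_nonincreasing ch _ _; have := MP _ qq; rewrite !mulSn mulnDl; lia.
have point q : (internal n f nu j q)%:R <= (0 <= q < 2 * P)%:R +
    (q1 <= q < M.+1)%:R + (2 * P <= q < q1)%:R *
    ((D f q + D nu q) * (m%:R * Num.sqrt m%:R)) :> R.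
  have [q2P|q2P] := ltnP q (2 * P).
    rewrite mul0r addr0 (@le_trans _ _ 1)// ?ler1n ?ler_nat//; last by rewrite lerDl.
    by rewrite lern1 leq_b1.
  have [qq1|q1q] := ltnP q q1.
    rewrite /= mul1r !add0r.
    have hq : (2 * P <= q < q1)%N by rewrite q2P.
    have df := D0 f q cf hq; have dnu := D0 nu q cnu hq.
    have c0 : 0 < m%:R * Num.sqrt m%:R :> R by rewrite mulr_gt0.
    rewrite /internal -/m; case: ltnP => //= _; last by apply: mulr_ge0; [exact: addr_ge0|exact: ltW].
    rewrite ltnNge (_ : (q.+1 * m <= n)%N) /=; last first.
      by apply: leq_trans (MP _ qq1); rewrite leq_mul2r; lia.
    have [hb|hb] := boolP (bent f j q).
      by apply: le_trans (bentD f q cf hq hb) _; rewrite ler_pM2r// lerDl.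
    have [hb'|hb'] := boolP (bent nu j q); last by apply: mulr_ge0; [exact: addr_ge0|exact: ltW].
    by apply: le_trans (bentD nu q cnu hq hb') _; rewrite ler_pM2r// lerDr.
  rewrite /= mul0r addr0 add0r ler_nat /internal -/m ltnS leq_divRL//.
  by case: ltnP => //= /ltnW ->; case: (_ || _).
(* [nu] obeys the same slope bounds as f, with perturbation 0. *)
have vv0 : dot 0 n (fun=> 0) (fun=> 0) <= t ^+ 2 :> R.
  by rewrite /dot big1 ?sqr_ge0// => i _; rewrite mulr0.
pose K (s : R) := H / (P * m)%:R + 3 / 2 * s / ((P * m)%:R * Num.sqrt (P * m)%:R).
have tele h w : concave_upto n h -> (forall i, (i < n)%N -> h i = nu i + w i) ->
    dot 0 n w w <= t ^+ 2 -> \sum_(2 * P <= q < q1) D h q <= 2 * K t.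
  move=> ch hE wt; have [q1P|Pq1] := leqP q1 (2 * P).
    rewrite big_geq// mulr_ge0// addr_ge0// ?divr_ge0// ?mulr_ge0// ltW//.
  have := @telescope_sumr _ (2 * P) q1 (fun q => - slope h (q * m)%N) (ltnW Pq1).
  rewrite (eq_bigr (D h)); last by move=> q _; rewrite /D opprK addrC.
  move=> ->; rewrite opprK addrC mulr_natl mulr2n.
  have n1 := MP q1.-1; rewrite prednK in n1; last by lia.
  have {}n1 := n1 (leqnn _).
  have a0 : (0 < P * m)%N by rewrite muln_gt0 P0.
  apply: lerD.
    apply: slope_le ch a0 _ _ hE nuH t0 wt; first by rewrite mulnA.
    have : (2 * P * m <= q1 * m)%N by rewrite leq_mul2r ltnW ?orbT.
    by move: n1; rewrite !mulSn mulnDl; lia.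
  rewrite lerNl; apply: slope_ge ch a0 _ hE nuH t0 wt.
  by move: n1; rewrite mulnDl mulSn -mulnA; lia.
apply: (@le_trans _ _ (\sum_(0 <= q < N) ((0 <= q < 2 * P)%:R +
    (q1 <= q < M.+1)%:R + (2 * P <= q < q1)%:R *
    ((D f q + D nu q) * (m%:R * Num.sqrt m%:R))))).
  by apply: ler_sum => q _; exact: point.
rewrite 2!big_split/=.
have s1 := sum_window1_le R N 0 (2 * P).
have s2 := sum_window1_le R N q1 M.+1.
have s3 := @sum_window_le R N (2 * P) q1 (fun q => (D f q + D nu q) * (m%:R * Num.sqrt m%:R)).
have {}s3 : \sum_(0 <= q < N) (2 * P <= q < q1)%:R * ((D f q + D nu q) * (m%:R * Num.sqrt m%:R))
    <= 4 * K t * (m%:R * Num.sqrt m%:R).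
  apply: le_trans (s3 _) _.
    by move=> q hq; apply: mulr_ge0; [rewrite addr_ge0 ?D0|rewrite mulr_ge0// ltW].
  rewrite /= -mulr_suml; apply: ler_wpM2r; first by apply: mulr_ge0; exact: ltW.
  rewrite big_split/=.
  have := tele f v cf fE vt; have := tele nu (fun=> 0) cnu _ vv0.
  by move=> /(_ ltac:(by move=> i _; rewrite addr0)); lra.
have e2 : (M.+1 - q1)%:R <= 2 * P%:R + 2 :> R.
  by rewrite -natrM -[2 in leRHS]/(2%:R) -natrD ler_nat /q1; lia.
have e1 : (2 * P - 0)%:R = 2 * P%:R :> R by rewrite subn0 natrM.
have eK : 4 * K t * (m%:R * Num.sqrt m%:R) <= 4 * (Num.sqrt m%:R * H) / P%:R + 6 * t.
  have sP0 : 0 < Num.sqrt P%:R :> R by rewrite sqrtr_gt0.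
  have -> : 4 * K t * (m%:R * Num.sqrt m%:R) = 4 * (Num.sqrt m%:R * H) / P%:R +
      6 * t / (P%:R * Num.sqrt P%:R).
    rewrite /K natrM sqrtrM ?ltW//; field.
    by rewrite !gt_eqF.
  rewrite lerD2l ler_pdivrMr ?mulr_gt0//; apply: ler_peMr.
    by apply: mulr_ge0 => //; exact: ltW.
  have P1 : 1 <= P%:R :> R by rewrite ler1n.
  have : 1 <= Num.sqrt P%:R :> R by rewrite -[X in X <= _]sqrtr1 ler_wsqrtr.
  by move=> sP1; exact: mulr_ege1.
by rewrite e1 in s1; lra.
Qed.

(** * Summing over scales *)

(** A binary tree has one leaf more than it has internal nodes. The sum also counts marked cells
    below an uncut one, whence an inequality. *)
Lemma leaves_le (int : nat -> nat -> bool) (j p : nat) :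
  (leaves int j p <= 1 + \sum_(1 <= i < j.+1)
     \sum_(p * 2 ^ (j - i) <= q < p.+1 * 2 ^ (j - i)) int i q)%N.
Proof.
elim: j p => [|j IH] p /=; first by rewrite big_geq.
rewrite big_nat_recr//= subnn expn0 !muln1 big_nat1.
case: (int j.+1 p); last by rewrite leq_addr.
have E : (\sum_(1 <= i < j.+1)
     \sum_(p * 2 ^ (j.+1 - i) <= q < p.+1 * 2 ^ (j.+1 - i)) int i q =
  \sum_(1 <= i < j.+1) \sum_(p.*2 * 2 ^ (j - i) <= q < p.*2.+1 * 2 ^ (j - i)) int i q +
  \sum_(1 <= i < j.+1) \sum_(p.*2.+1 * 2 ^ (j - i) <= q < p.*2.+2 * 2 ^ (j - i)) int i q)%N.
  rewrite -big_split/=; apply: eq_big_nat => i /andP[_]; rewrite ltnS => ij.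
  rewrite subSn// expnS !mulnA !muln2 -doubleS.
  by rewrite -big_cat_nat//= leq_mul2r leqnSn orbT.
by rewrite E; have := IH p.*2; have := IH p.*2.+1; lia.
Qed.

Lemma geometric_sum_le (R : realType) (q : R) (k : nat) : 1 < q ->
  \sum_(0 <= j < k) q ^+ j <= q ^+ k / (q - 1).
Proof.
move=> q1; have q10 : 0 < q - 1 by lra.
elim: k => [|k IH]; first by rewrite big_geq// divr_ge0// ?exprn_ge0//; lra.
rewrite big_nat_recr//= exprS.
rewrite (_ : q * q ^+ k / (q - 1) = q ^+ k / (q - 1) + q ^+ k); first by lra.
by field; rewrite gt_eqF.
Qed.

(* Both sequences are compared at the scale where they cross; there they equal
   w, because (a / 2^j) (b q^j)^4 = a b^4 for every j. *)
Lemma sum_min_geometric_le (R : realType) (a b q w : R) (c : nat -> R) (N : nat) :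
  0 < a -> 0 < b -> 1 < q -> q ^+ 4 = 2 -> 0 <= w -> w ^+ 5 = a * b ^+ 4 ->
  (forall j, (j < N)%N -> c j <= a / 2 ^+ j) ->
  (forall j, (j < N)%N -> c j <= b * q ^+ j) ->
  \sum_(0 <= j < N) c j <= (2 + q / (q - 1)) * w.
Proof.
move=> a0 b0 q1 q4 w0 w5 ca cb.
have q0 : 0 < q by lra.
have q10 : 0 < q - 1 by lra.
have A0 j : 0 < a / 2 ^+ j by rewrite divr_gt0// exprn_gt0.
have B0 j : 0 < b * q ^+ j by rewrite mulr_gt0// exprn_gt0.
have AB j : (a / 2 ^+ j) * (b * q ^+ j) ^+ 4 = w ^+ 5.
  rewrite w5 exprMn -exprM mulnC exprM q4; field.
  by rewrite expf_neq0.
have Aw j : a / 2 ^+ j <= b * q ^+ j -> a / 2 ^+ j <= w.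
  move=> h; rewrite -(@ler_pXn2r _ 5)// ?nnegrE ?(ltW (A0 j))// -(AB j) exprS.
  by rewrite ler_pM2l// lerXn2r ?nnegrE ?(ltW (A0 j)) ?(ltW (B0 j)).
have Bw j : b * q ^+ j <= a / 2 ^+ j -> b * q ^+ j <= w.
  move=> h; rewrite -(@ler_pXn2r _ 5)// ?nnegrE ?(ltW (B0 j))// -(AB j) exprS.
  by rewrite ler_pM2r ?exprn_gt0.
(* The first scale at which the decreasing bound is the smaller one, or N if there is none. From
   [j0] on the decreasing bound is summed, before [j0] the increasing one; both sums are dominated
   by their terms next to the crossing, which are at most w. *)
pose j0 := find (fun j => a / 2 ^+ j <= b * q ^+ j) (iota 0 N).
have j0N : (j0 <= N)%N by rewrite -[N in (_ <= N)%N](size_iota 0) find_size.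
rewrite (@big_cat_nat _ _ _ j0)//= mulrDl addrC lerD//.
  have [->|j0N'] := eqVneq j0 N; first by rewrite big_geq// mulr_ge0.
  have j0lt : (j0 < N)%N by rewrite ltn_neqAle j0N'.
  have hA : a / 2 ^+ j0 <= w.
    apply: Aw; have : has (fun j => a / 2 ^+ j <= b * q ^+ j) (iota 0 N).
      by rewrite has_find size_iota.
    by move=> /(nth_find 0%N); rewrite -/j0 nth_iota.
  apply: (@le_trans _ _ (2 * (a / 2 ^+ j0))); last by rewrite ler_pM2l.
  have H k : \sum_(j0 <= j < j0 + k) a / 2 ^+ j <=
      2 * (a / 2 ^+ j0) - 2 * (a / 2 ^+ (j0 + k)).
    elim: k => [|k IH]; first by rewrite addn0 big_geq// subrr.
    rewrite addnS big_nat_recr ?leq_addr//= [in leRHS]exprS invfM.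
    rewrite (_ : 2 * (a * (2^-1 / 2 ^+ (j0 + k))) = a / 2 ^+ (j0 + k)); last by field; rewrite expf_neq0.
    by lra.
  have h := H (N - j0)%N; rewrite subnKC// in h.
  apply: (@le_trans _ _ (\sum_(j0 <= j < N) a / 2 ^+ j)).
    by rewrite big_nat_cond [leRHS]big_nat_cond; apply: ler_sum => j /andP[/andP[_ jN] _]; exact: ca.
  by apply: le_trans h _; rewrite lerBlDr lerDl mulr_ge0// ltW.
have [j00|j00] := posnP j0; first by rewrite j00 big_geq// mulr_ge0 ?divr_ge0// ltW.
have hB : b * q ^+ j0.-1 <= w.
  apply: Bw; rewrite leNgt; apply/negP => h.
  have : (j0.-1 < j0)%N by rewrite prednK.
  by move=> /(before_find 0%N); rewrite nth_iota ?add0n ?(ltW h)//; lia.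
apply: (@le_trans _ _ (\sum_(0 <= j < j0) b * q ^+ j)).
  rewrite big_nat_cond [leRHS]big_nat_cond; apply: ler_sum => j /andP[/andP[_ jN] _].
  by apply: cb; exact: leq_trans jN j0N.
rewrite -mulr_sumr; apply: (@le_trans _ _ (b * (q ^+ j0 / (q - 1)))).
  by rewrite ler_pM2l// geometric_sum_le.
rewrite -(prednK j00) exprS (_ : b * _ = q / (q - 1) * (b * q ^+ j0.-1)); last by ring.
by rewrite ler_wpM2l// divr_ge0// ltW.
Qed.

Lemma sqrtrX (R : realType) (x : R) k : 0 <= x -> Num.sqrt (x ^+ k) = Num.sqrt x ^+ k.
Proof.
move=> x0; rewrite -[RHS]ger0_norm ?exprn_ge0 ?sqrtr_ge0// -sqrtr_sqr.
by rewrite -exprM mulnC exprM sqr_sqrtr.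
Qed.

(** With m = 2^j, [internal_count_cut] is applied to an integer P just above the square root of
    sqrt(m) (H + 1), which balances 4 P against 4 sqrt(m) H / P. *)
Lemma internal_count (R : realType) n (f nu v : nat -> R) (H t : R) j N :
  concave_upto n f -> concave_upto n nu ->
  (forall i, (i < n)%N -> f i = nu i + v i) ->
  (forall i k, (i < n)%N -> (k < n)%N -> nu i - nu k <= H) ->
  0 <= H -> 0 < t -> dot 0 n v v <= t ^+ 2 -> (0 < j)%N ->
  \sum_(0 <= q < N) (internal n f nu j q)%:R <=
    6 + 6 * t + 8 * (Num.sqrt (H + 1) * Num.sqrt (Num.sqrt 2) ^+ j).
Proof.
move=> cf cnu fE nuH H0 t0 vt j0.
have -> : Num.sqrt (H + 1) * Num.sqrt (Num.sqrt 2) ^+ j =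
    Num.sqrt (Num.sqrt (2 ^ j)%:R * (H + 1)).
  rewrite sqrtrM ?sqrtr_ge0// natrX sqrtrX// sqrtrX ?sqrtr_ge0//.
  by rewrite mulrC.
set m := (2 ^ j)%N; set y := Num.sqrt m%:R * (H + 1); pose s : R := Num.sqrt y.
have m1 : 1 <= Num.sqrt m%:R :> R.
  by rewrite -[X in X <= _]sqrtr1 ler_wsqrtr// ler1n expn_gt0.
have y1 : 1 <= y by apply: mulr_ege1 => //; lra.
have s1 : 1 <= s by rewrite -[X in X <= _]sqrtr1 ler_wsqrtr.
have sE : s ^+ 2 = y by rewrite sqr_sqrtr// (le_trans ler01).
have s0 : 0 <= s by lra.
have /Num.Theory.truncn_itv/andP[P1 P2] := s0.
have := @internal_count_cut R n f nu v H t j N (Num.truncn s).+1 cf cnu fE nuH H0 t0 vt isT j0.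
move=> /le_trans; apply; rewrite -/m -/s.
have hP : (Num.truncn s).+1%:R <= s + 1 by rewrite -natr1 lerD2r.
set P : R := (Num.truncn s).+1%:R in P2 hP *.
have : 4 * (Num.sqrt m%:R * H) / P <= 4 * s.
  rewrite ler_pdivrMr; last by lra.
  have : Num.sqrt m%:R * H <= y by rewrite /y ler_pM2l; lra.
  have : s * s <= s * P by rewrite ler_pM2l; lra.
  by rewrite -expr2 sE; lra.
move: (4 * _ / P) => X; lra.
Qed.

(** For s = sqrt(w) and J the truncated logarithm, 2^J <= n <= s^10, so J ln 2 <= 10 ln s <= 10 (s -
    1). *)
Lemma log2_sqr_le (R : realType) : exists2 K : R, 0 < K &
  forall (n : nat) (w : R), (0 < n)%N -> 1 <= w -> n%:R <= w ^+ 5 ->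
  (trunc_log 2 n).+2%:R ^+ 2 <= K * w.
Proof.
have l2 : 0 < ln 2 :> R by rewrite ln_gt0// ltr1n.
exists ((2 + 10 / ln 2) ^+ 2); first by rewrite exprn_gt0// addr_gt0// divr_gt0.
move=> n w n0 w1 nw.
have w0 : 0 <= w by lra.
pose s := Num.sqrt w.
have sE : s ^+ 2 = w by rewrite sqr_sqrtr.
have s1 : 1 <= s by rewrite -[X in X <= _]sqrtr1 ler_wsqrtr.
rewrite -sE -exprMn lerXn2r ?nnegrE//.
  by rewrite mulr_ge0 ?addr_ge0 ?divr_ge0 ?ltW//; lra.
set J := trunc_log 2 n.
have Jn : 2 ^+ J <= s ^+ 10.
  rewrite -[10%N]/(2 * 5)%N exprM sE; apply: le_trans nw.
  by rewrite -natrX ler_nat trunc_logP.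
have : J%:R * ln 2 <= 10 * s.
  have : ln (2 ^+ J) <= ln (s ^+ 10) by rewrite ler_ln// ?posrE ?exprn_gt0//; lra.
  rewrite !lnXn//; last by lra.
  rewrite -[ln 2 *+ J]mulr_natl -[ln s *+ 10]mulr_natl => /le_trans; apply.
  rewrite ler_pM2l// ltW//; have := @le_ln1Dx R (s - 1); rewrite (_ : 1 + (s - 1) = s); last by ring.
  by move=> /(_ ltac:(lra)); lra.
rewrite -ler_pdivlMr// => h.
by rewrite -addn2 natrD; lra.
Qed.

(* AM-GM: [6 L j s <= s^2 / 136 + 1224 L^2 j^2]. *)
Lemma absorb_linear_term (R : realFieldType) (L K C1 N D j s k w : R) :
  0 < L -> 0 <= j ->
  L * N <= L * (1 + j * (6 + 6 * (s + 1)) + 8 * (C1 * w)) ->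
  j + 1 <= k -> j ^+ 2 <= k -> k <= K * w ->
  (2 * D - s ^+ 2) / 17 - ((13 * L + 1224 * L ^+ 2) * K + 8 * L * C1) * w <=
  (2 * D - 7 / 8 * s ^+ 2) / 17 - L * N.
Proof.
move=> L0 j0 e1 jk jjk kw.
have LL : 0 <= L ^+ 2 by rewrite sqr_ge0.
have LJ : 0 <= L * j by rewrite mulr_ge0// ltW.
have am := sqr_ge0 (s - 408 * L * j).
have e2 := ler_wpM2l LL jjk.
have e3 := ler_wpM2l (ltW L0) jk.
have e4 := ler_wpM2l (ltW L0) kw.
have e5 := ler_wpM2l LL kw.
by lra.
Qed.

(** Cutting the [internal] cells gives O(w + (1 + |v|) log n) leaves. The eighth of |v|^2 that
    [tree_mixture] holds back absorbs |v| log n at the price of a multiple of (log n)^2, which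
    [log2_sqr_le] bounds by w. *)
Lemma concave_mixture (R : realType) : exists2 C : R, 0 < C &
  forall n G : nat, (0 < n)%N ->
  exists2 phi, mixture n 0 (1 * 2 ^ (trunc_log 2 n).+1) (1 / 2 : R) phi &
  forall (g f nu v : nat -> R) (H w : R),
  (forall i, (i < n)%N -> `|g i| <= G%:R) ->
  concave_upto n f -> concave_upto n nu ->
  (forall i, (i < n)%N -> v i = f i - nu i) ->
  (forall i k, (i < n)%N -> (k < n)%N -> nu i - nu k <= H) ->
  0 <= H -> 1 <= w -> w ^+ 5 = n%:R * (H + 1) ^+ 2 ->
  expR ((2 * dot 0 n g v - dot 0 n v v) / 17 - C * w) <= phi g.
Proof.
have [K K0 HK] := log2_sqr_le R.
pose L := leaf_cost R.
have L0 : 0 < L by rewrite mulr_gt0// exprn_gt0// expR_gt0.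
pose q : R := Num.sqrt (Num.sqrt 2).
have q4 : q ^+ 4 = 2.
  by rewrite -[4%N]/(2 * 2)%N exprM !sqr_sqrtr ?sqrtr_ge0.
have q1 : 1 < q.
  rewrite -(@ltr_pXn2r _ 4)// ?nnegrE ?sqrtr_ge0// q4 expr1n.
  by lra.
pose C1 := 2 + q / (q - 1).
have C10 : 0 <= C1 by rewrite addr_ge0// divr_ge0//; lra.
exists ((13 * L + 1224 * L ^+ 2) * K + 8 * L * C1).
  have L2 : 0 < L ^+ 2 by exact: exprn_gt0.
  apply: ltr_pwDl; last by apply: mulr_ge0 => //; lra.
  by apply: mulr_gt0; [lra|exact: K0].
move=> n G n0; set J := (trunc_log 2 n).+1.
have [phi mphi Hphi] := tree_mixture R n G J 0.
exists phi => // g f nu v0 H w gG cf cnu v0E nuH H0 w1 w5.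
(* The root cell [0, 2^J) reaches past n, so v is continued by 0. *)
pose v i := if (i < n)%N then v0 i else 0.
have vE i : (i < n)%N -> v i = v0 i by rewrite /v => ->.
have nv i : (n <= i)%N -> v i = 0 by rewrite /v ltnNge => ->.
have fE i : (i < n)%N -> f i = nu i + v i by move=> ni; rewrite vE// v0E//; ring.
have nJ : (n <= 1 * 2 ^ J)%N by rewrite mul1n ltnW// trunc_log_ltn.
have dn (h : nat -> R) : dot 0 (1 * 2 ^ J) h v = dot 0 n h v.
  rewrite (@dot_cat _ 0 n)//= [X in _ + X]big_nat_cond [X in _ + X]big1 ?addr0//.
  by move=> i /andP[/andP[ni _] _]; rewrite nv ?mulr0.
have dv0 (h : nat -> R) : dot 0 n h v = dot 0 n h v0.
  by apply: eq_big_nat => i /andP[_ ni]; rewrite vE.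
have dvv : dot 0 n v v = dot 0 n v0 v0.
  by apply: eq_big_nat => i /andP[_ ni]; rewrite vE.
have := Hphi g v (internal n f nu) gG nv
  (fun k q0 => @internalPn R n f nu v k.+1 q0 cf cnu fE).
rewrite mul0n !dn; apply: le_trans; rewrite ler_expR dvv dv0.
set d := dot 0 n v0 v0.
have d0 : 0 <= d by exact: dot_ge0.
pose s : R := Num.sqrt d.
have sE : s ^+ 2 = d by rewrite sqr_sqrtr.
have s0 : 0 <= s by exact: sqrtr_ge0.
(* The radius s + 1 replaces s, which may vanish, because [internal_count] divides by a positive
   radius in its proof. *)
have t0 : 0 < s + 1 by lra.
have vt : dot 0 n v v <= (s + 1) ^+ 2 by rewrite dvv -/d -sE lerXn2r ?nnegrE; lra.
have cnt j N : (0 < j)%N -> _ :=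
  @internal_count R n f nu v H (s + 1) j N cf cnu fE nuH H0 t0 vt.
have leavesle : (leaves (internal n f nu) J 0)%:R <=
    1 + J%:R * (6 + 6 * (s + 1)) + 8 * (C1 * w).
  have := leaves_le (internal n f nu) J 0.
  rewrite -(ler_nat R) natrD => /le_trans; apply.
  rewrite -addrA lerD2l natr_sum.
  pose E := 6 + 6 * (s + 1).
  pose X i : R := \sum_(0 * 2 ^ (J - i) <= q0 < 1 * 2 ^ (J - i)) (internal n f nu i q0)%:R.
  (* The count at scale i without its additive part; it has both a decreasing and an increasing
     geometric bound. Scale 0 does not occur in [leaves_le]. *)
  pose c i := if i is 0%N then 0 else (X i - E) / 8.
  have w0 : 0 <= w by lra.
  have h0 : 0 < Num.sqrt (H + 1) by rewrite sqrtr_gt0; lra.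
  have n0R : 0 < n%:R :> R by rewrite ltr0n.
  have := @sum_min_geometric_le R n%:R (Num.sqrt (H + 1)) q w c J.+1 n0R h0 q1 q4 w0.
  rewrite (_ : Num.sqrt (H + 1) ^+ 4 = (H + 1) ^+ 2); last first.
    by rewrite -[4%N]/(2 * 2)%N exprM sqr_sqrtr//; lra.
  have cA j : (j < J.+1)%N -> c j <= n%:R / 2 ^+ j.
    case: j => [|j] _; first by rewrite /c expr0 divr1 ltW.
    rewrite /c ler_pdivrMr// lerBlDr.
    have := internal_count_all n f nu j.+1 (1 * 2 ^ (J - j.+1)).
    rewrite natrX => /le_trans; apply.
    have : 0 <= n%:R / 2 ^+ j.+1 :> R by rewrite divr_ge0// exprn_ge0.
    by rewrite /E; lra.
  have cB j : (j < J.+1)%N -> c j <= Num.sqrt (H + 1) * q ^+ j.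
    case: j => [|j] _; first by rewrite /c expr0 mulr1 ltW.
    rewrite /c ler_pdivrMr// lerBlDr.
    have := cnt j.+1 (1 * 2 ^ (J - j.+1))%N isT.
    by rewrite /X mul0n => /le_trans; apply; rewrite /E -/q; lra.
  move=> /(_ w5 cA cB) hc.
  rewrite (@big_ltn _ _ _ 0)// (_ : c 0%N = 0)// add0r in hc.
  rewrite (eq_big_nat _ _ (F2 := fun i => E + 8 * c i)); last first.
    move=> i /andP[]; case: i => // i _ _.
    by rewrite natr_sum /c [8 * _]mulrC divfK// addrC subrK.
  rewrite big_split/= sumr_const_nat subSS subn0 -[E *+ J]mulr_natl lerD2l -mulr_sumr.
  by rewrite ler_pM2l.
have nw : n%:R <= w ^+ 5.
  rewrite w5 ler_peMr// -[1](expr1n _ 2) lerXn2r ?nnegrE//; lra.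
have := HK n w n0 w1 nw; rewrite -/J.
set k : R := J.+1%:R ^+ 2 => kw.
have Jk : J%:R + 1 <= k.
  rewrite /k -natr1 expr2; apply: ler_peMr; first exact: addr_ge0.
  by rewrite lerDr.
have JJk : J%:R ^+ 2 <= k by rewrite /k lerXn2r ?nnegrE// ler_nat.
have e1 : L * (leaves (internal n f nu) J 0)%:R <=
    L * (1 + J%:R * (6 + 6 * (s + 1)) + 8 * (C1 * w)) by rewrite ler_pM2l.
rewrite -/L -sE; exact: absorb_linear_term L0 (ler0n _ _) e1 Jk JJk kw.
Qed.

(** * Laplace transform of Gaussian vectors *)

Section weighted.
Import HBNNSimple.

(** Change of variables when [nu] is the image under X of the measure with density F: the hypothesis
    on sets extends to simple functions by linearity and to nonnegative functions by monotone
    convergence. It serves both for the normal density and for replacing one coordinate in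
    [indep_exp_moment]. *)
Lemma ge0_integral_weighted d1 d2 (T : measurableType d1) (U : measurableType d2)
    (R : realType) (mu : {measure set T -> \bar R}) (nu : {measure set U -> \bar R})
    (X : T -> U) (F : T -> R) :
  measurable_fun setT X -> measurable_fun setT F -> (forall t, 0 <= F t) ->
  (forall B, measurable B -> (\int[mu]_(t in X @^-1` B) (F t)%:E)%E = nu B) ->
  forall f : U -> \bar R, measurable_fun setT f -> (forall u, 0 <= f u)%E ->
  (\int[mu]_t ((F t)%:E * f (X t)) = \int[nu]_u f u)%E.
Proof.
move=> mX mF F0 FB f mf f0.
pose f_ := nnsfun_approx measurableT mf.
have mXB B : measurable B -> measurable (X @^-1` B).
  by move=> mB; rewrite -[X in measurable X]setTI; exact: mX.
have mfX n : measurable_fun setT (fun t => (f_ n (X t))%:E).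
  by apply/measurable_EFinP; apply: measurableT_comp.
transitivity (limn (fun n => \int[mu]_t ((F t)%:E * (f_ n (X t))%:E)))%E.
  rewrite -monotone_convergence//.
  - apply: eq_integral => t _; apply/esym/cvg_lim => //.
    by apply: cvgeZl => //; apply: (cvg_nnsfun_approx measurableT mf).
  - by move=> n; apply: emeasurable_funM => //; exact/measurable_EFinP.
  - by move=> n t _; rewrite mule_ge0// lee_fin.
  - move=> t _ m n mn; rewrite lee_wpmul2l ?lee_fin//.
    exact/lefP/nd_nnsfun_approx.
transitivity (limn (fun n => \int[nu]_u (f_ n u)%:E))%E; last first.
  rewrite -monotone_convergence//.
  - apply: eq_integral => t _; apply/cvg_lim => //.
    by apply: (cvg_nnsfun_approx measurableT mf).
  - by move=> n; apply/measurable_EFinP.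
  - by move=> n t _; rewrite lee_fin.
  - move=> t _ m n mn; rewrite lee_fin.
    exact/lefP/nd_nnsfun_approx.
congr (limn _); apply/funext => n.
have fE u : f_ n u = \sum_(y \in range (f_ n)) y * \1_(f_ n @^-1` [set y]) u.
  by rewrite -fimfunE.
have mI y : measurable_fun setT (fun t => \1_(f_ n @^-1` [set y]) (X t) : R).
  rewrite (_ : (fun t => _) = \1_(X @^-1` (f_ n @^-1` [set y])))//.
  exact/measurable_indic/mXB.
rewrite integralT_nnsfun sintegralE.
transitivity (\sum_(y \in range (f_ n))
    \int[mu]_t (y%:E * ((F t)%:E * (\1_(f_ n @^-1` [set y]) (X t))%:E)))%E.
  rewrite -ge0_integral_fsum//; last 2 first.
  - move=> y; apply: emeasurable_funM => //.
    apply: emeasurable_funM; first exact/measurable_EFinP.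
    exact/measurable_EFinP/mI.
  - move=> y t _.
    have [y0|y0] := leP 0 y.
      by rewrite mule_ge0// mule_ge0// lee_fin.
    by rewrite preimage_nnfun0// indicE in_set0 mule0 mule0.
  apply: eq_integral => t _; rewrite fE -fsumEFin//.
  rewrite ge0_mule_fsumr; last first.
    move=> y; have [y0|y0] := leP 0 y; first by rewrite lee_fin mulr_ge0.
    by rewrite preimage_nnfun0// indicE in_set0 mulr0.
  by apply: eq_fsbigr => y _; rewrite EFinM muleCA.
apply: eq_fsbigr => y _.
have [y0|y0] := leP 0 y; last first.
  rewrite preimage_nnfun0// measure0 mule0.
  under eq_integral do rewrite indicE in_set0 mule0 mule0.
  by rewrite integral0.
have m1 : measurable (f_ n @^-1` [set y]) by [].
rewrite ge0_integralZl//; last first.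
- by move=> t _; rewrite mule_ge0// lee_fin.
- apply: emeasurable_funM; first exact/measurable_EFinP.
    exact/measurable_EFinP/mI.
congr (_ * _)%E; rewrite -(FB _ m1) [in RHS]integral_mkcond.
apply: eq_integral => t _; rewrite epatch_indic//.
Qed.

End weighted.

(** Completing the square: e^(b x) times the centred density is e^(s^2 b^2 / 2) times the density
    with mean s^2 b. *)
Lemma normal_exp_moment (R : realType) (s b : R) : s != 0 ->
  (\int[normal_prob 0 s]_x (expR (b * x))%:E = (expR (s ^+ 2 * b ^+ 2 / 2))%:E)%E.
Proof.
move=> s0.
rewrite -(@ge0_integral_weighted _ _ _ _ _ (@lebesgue_measure R) (normal_prob 0 s)
   id (normal_pdf 0 s) _ _ _ _ (fun x => (expR (b * x))%:E)) //.
- transitivity (\int[@lebesgue_measure R]_x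
    ((expR (s ^+ 2 * b ^+ 2 / 2))%:E * (normal_pdf (s ^+ 2 * b) s x)%:E))%E.
    apply: eq_integral => x _; rewrite -!EFinM; congr EFin.
    rewrite !(normal_pdfE _ s0) -[LHS]mulrA [RHS]mulrCA.
    congr (_ * _).
    rewrite /normal_fun -!expRD; congr expR.
    by field.
  rewrite ge0_integralZl ?integral_normal_pdf ?mule1//.
  + by apply/measurable_EFinP; exact: measurable_normal_pdf.
  + by move=> x _; rewrite lee_fin normal_pdf_ge0.
- exact: measurable_normal_pdf.
- by move=> x; rewrite normal_pdf_ge0.
- by apply/measurable_EFinP; apply: measurableT_comp.
Qed.

(* Independence is needed only through the Laplace transform of the vector X:
   exponentials are substituted for indicators one coordinate at a time. *)
Lemma indep_exp_moment (R : realType) (d : measure_display)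
    (T : measurableType d) (P : probability T R) (I : finType)
    (s : R) (X : I -> {RV P >-> R}) (b : I -> R) :
  s != 0 -> iid_centered_normal s X ->
  forall (r : seq I) (J : {set I}) (B : I -> set R),
  uniq r -> {in r, forall i, i \notin J} -> (forall i, measurable (B i)) ->
  (\int[P]_(w in \bigcap_(i in [set` J]) (X i @^-1` B i))
     (\prod_(i <- r) expR (b i * X i w))%:E =
   (\prod_(i <- r) expR (s ^+ 2 * b i ^+ 2 / 2))%:E *
   \prod_(i in J) P (X i @^-1` B i))%E.
Proof.
move=> s0 [indX lawX]; elim=> [|k r IH] J B.
  move=> _ _ mB; rewrite big_nil mul1e -indX//.
  under eq_integral do rewrite big_nil.
  rewrite integral_cst ?mul1e//.
  apply: fin_bigcap_measurable => // i _.
  by rewrite -[X in measurable X]setTI; exact: measurable_funPT.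
rewrite cons_uniq => /andP[kr ur] rJ mB.
have mX i A : measurable A -> measurable (X i @^-1` A).
  by move=> mA; rewrite -[X in measurable X]setTI; exact: measurable_funPT.
have kJ : k \notin J by apply: rJ; rewrite mem_head.
set E := \bigcap_(i in _) _.
have mE : measurable E by apply: fin_bigcap_measurable => // i _; exact: mX.
(* The weight formed by the other exponentials and the event E. By the induction hypothesis for J
   with k added, the law of [X k] under this weight is a multiple of the normal law. *)
pose F w := (\prod_(i <- r) expR (b i * X i w)) * \1_E w.
have mprod : measurable_fun setT (fun w => \prod_(i <- r) expR (b i * X i w)).
  apply: measurable_prod => i _; apply: measurableT_comp => //.
  exact: measurable_funM.
have mF : measurable_fun setT F.
  by apply: measurable_funM => //; exact: measurable_indic.
have F0 w : 0 <= F w by rewrite mulr_ge0// prodr_ge0// => i _; exact: expR_ge0.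
have cfin : (\prod_(i in J) P (X i @^-1` B i))%E \is a fin_num.
  by rewrite prode_fin_num// => i iJ; rewrite fin_num_measure//; exact: mX.
have c0 : 0 <= \prod_(i <- r) expR (s ^+ 2 * b i ^+ 2 / 2) *
    fine (\prod_(i in J) P (X i @^-1` B i))%E.
  by rewrite mulr_ge0 ?fine_ge0 ?prode_ge0// prodr_ge0// => i _; exact: expR_ge0.
pose c := NngNum c0.
transitivity (\int[P]_w ((F w)%:E * (expR (b k * X k w))%:E))%E.
  rewrite integral_mkcond; apply: eq_integral => w _.
  rewrite /F /patch indicE; case: ifPn => _; last by rewrite mulr0 mul0e.
  by rewrite mulr1 big_cons mulrC EFinM.
rewrite (@ge0_integral_weighted _ _ _ _ _ P (mscale c (normal_prob 0 s)) (X k) F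
  _ _ _ _ (fun x => (expR (b k * x))%:E)).
- rewrite ge0_integral_mscale//; last by apply/measurable_EFinP; apply: measurableT_comp.
  rewrite normal_exp_moment// big_cons /= -[in RHS](fineK cfin) -!EFinM.
  by congr EFin; rewrite mulrC mulrA.
- exact: (@measurable_funPT _ _ _ _ (X k)).
- exact: mF.
- exact: F0.
- move=> A mA; pose B' i := if i == k then A else B i.
  have B'E i : i \in J -> B' i = B i.
    by move=> iJ; rewrite /B' ifF//; apply: contraNF kJ => /eqP <-.
  have B'k : B' k = A by rewrite /B' eqxx.
  have EA : \bigcap_(i in [set` k |: J]) (X i @^-1` B' i) = X k @^-1` A `&` E.
    apply/seteqP; split => w /=.
      move=> Ew; split; first by rewrite -B'k; apply: Ew; rewrite /= !inE eqxx.
      by move=> i /= iJ; rewrite -(B'E _ iJ); apply: Ew; rewrite /= !inE iJ orbT.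
    move=> [Aw Ew] i /=; rewrite !inE => /predU1P[->|iJ]; first by rewrite B'k.
    by rewrite B'E//; exact: Ew.
  have pA : (\prod_(i in k |: J) P (X i @^-1` B' i) =
      P (X k @^-1` A) * \prod_(i in J) P (X i @^-1` B i))%E.
    rewrite big_setU1//= B'k; congr (_ * _)%E.
    by apply: eq_bigr => i iJ; rewrite B'E.
  transitivity (c%:num%:E * P (X k @^-1` A))%E; last by congr (_ * _)%E; exact: lawX.
  rewrite EFinM fineK// -muleA [X in (_ * X)%E]muleC -pA -IH//.
  + rewrite EA [LHS]integral_mkcond [RHS]integral_mkcond; apply: eq_integral => w _.
    rewrite /patch in_setI; case: ifPn => //= _.
    by rewrite /F indicE; case: ifPn => _; rewrite ?mulr1 ?mulr0.
  + move=> i ir; rewrite !inE negb_or rJ ?andbT; last by rewrite inE ir orbT.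
    by apply: contraNneq kr => <-.
  + by move=> i; rewrite /B'; case: ifP.
- by apply/measurable_EFinP; apply: measurableT_comp.
- by move=> x; rewrite lee_fin expR_ge0.
Qed.

(** * Projections *)

Definition ip (R : realType) n (u v : 'rV[R]_n) : R := \sum_(i < n) u 0 i * v 0 i.

Lemma enorm_ge0 (R : realType) n (v : 'rV[R]_n) : 0 <= enorm v.
Proof. exact: sqrtr_ge0. Qed.

Lemma enorm_sqr (R : realType) n (v : 'rV[R]_n) : enorm v ^+ 2 = ip v v.
Proof.
rewrite sqr_sqrtr; last by apply: sumr_ge0 => i _; rewrite sqr_ge0.
by apply: eq_bigr => i _; rewrite expr2.
Qed.

Lemma enorm_le (R : realType) m n (u : 'rV[R]_m) (v : 'rV[R]_n) :
  (enorm u <= enorm v) = (enorm u ^+ 2 <= enorm v ^+ 2).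
Proof. by rewrite ler_pXn2r// nnegrE enorm_ge0. Qed.

Lemma coord_le_enorm (R : realType) n (v : 'rV[R]_n) i : `|v 0 i| <= enorm v.
Proof.
rewrite -sqrtr_sqr ler_wsqrtr// (bigD1 i)//= lerDl.
by apply: sumr_ge0 => j _; rewrite sqr_ge0.
Qed.

Lemma enorm_le_sum (R : realType) n (v : 'rV[R]_n) : enorm v <= \sum_(i < n) `|v 0 i|.
Proof.
have s0 : 0 <= \sum_(i < n) `|v 0 i| by exact: sumr_ge0.
rewrite -[leRHS]ger0_norm// -sqrtr_sqr ler_wsqrtr// expr2 mulr_suml.
apply: ler_sum => i _; rewrite -real_normK ?num_real// expr2 ler_wpM2l//.
by rewrite (bigD1 i)//= lerDl sumr_ge0.
Qed.

Lemma ipDl (R : realType) n (u v w : 'rV[R]_n) : ip (u + v) w = ip u w + ip v w.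
Proof. by rewrite -big_split/=; apply: eq_bigr => i _; rewrite mxE mulrDl. Qed.

Lemma ipC (R : realType) n (u v : 'rV[R]_n) : ip u v = ip v u.
Proof. by apply: eq_bigr => i _; rewrite mulrC. Qed.

Lemma ipZl (R : realType) n c (u v : 'rV[R]_n) : ip (c *: u) v = c * ip u v.
Proof. by rewrite mulr_sumr; apply: eq_bigr => i _; rewrite mxE mulrA. Qed.

Lemma ipNl (R : realType) n (u v : 'rV[R]_n) : ip (- u) v = - ip u v.
Proof. by rewrite -scaleN1r ipZl mulN1r. Qed.

Lemma ipDr (R : realType) n (u v w : 'rV[R]_n) : ip w (u + v) = ip w u + ip w v.
Proof. by rewrite ipC ipDl !(ipC w). Qed.

Lemma ipZr (R : realType) n c (u v : 'rV[R]_n) : ip v (c *: u) = c * ip v u.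
Proof. by rewrite ipC ipZl ipC. Qed.

Lemma ipNr (R : realType) n (u v : 'rV[R]_n) : ip v (- u) = - ip v u.
Proof. by rewrite ipC ipNl ipC. Qed.

Lemma ip_ge0 (R : realType) n (u : 'rV[R]_n) : 0 <= ip u u.
Proof. by rewrite -enorm_sqr sqr_ge0. Qed.

Lemma enorm_sqrB (R : realType) n (u v : 'rV[R]_n) :
  enorm (u - v) ^+ 2 = ip u u - 2 * ip u v + ip v v.
Proof.
by rewrite enorm_sqr !ipDl !ipDr !ipNl !ipNr (ipC v u); ring.
Qed.

Lemma enorm_continuous (R : realType) n (y : 'rV[R]_n) :
  continuous (fun u : 'rV[R]_n => enorm (y - u)).
Proof.
move=> u; have FFu : Filter (nbhs u) by exact: (@nbhs_filter 'rV[R]_n u).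
have h (r : seq 'I_n) : (fun u : 'rV[R]_n => \sum_(i <- r) (y - u) 0 i ^+ 2) @ u -->
    \sum_(i <- r) (y - u) 0 i ^+ 2.
  elim: r => [|i r IH].
    by rewrite big_nil; under eq_fun do rewrite big_nil; exact: cvg_cst.
  rewrite big_cons; under eq_fun do rewrite big_cons.
  apply: cvgD => //.
  apply: (@cvg_comp _ _ _ (fun u : 'rV[R]_n => (y - u) 0 i) (fun x => x ^+ 2));
  last exact: exprn_continuous.
  rewrite (_ : (fun u : 'rV[R]_n => (y - u) 0 i) = (fun u => y 0 i - u 0 i)); last first.
    by apply/funext => w; rewrite !mxE.
  rewrite mxE [(- u) 0 i]mxE.
  by apply: cvgB; [exact: cvg_cst|exact: coord_continuous].
by apply: (cvg_comp _ _ (h _)); exact: sqrt_continuous.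
Qed.

(** A minimizer exists by compactness of D intersected with the ball around y through a point of D.
    Leaving f free up to its order covers the distance in [eproj] and its square in [lse]. *)
Lemma argmin_spec (R : realType) n (D : set 'rV[R]_n) (y : 'rV[R]_n) (f : 'rV[R]_n -> R) :
  D !=set0 -> closed D ->
  (forall u v, (f u <= f v) = (enorm (y - u) <= enorm (y - v))) ->
  D (argmin D f) /\ forall u, D u -> enorm (y - argmin D f) <= enorm (y - u).
Proof.
move=> [x0 Dx0] cD fE.
suff [p [Dp hp]] : exists p, D p /\ forall u, D u -> enorm (y - p) <= enorm (y - u).
  have : [set x | D x /\ forall x', D x' -> f x <= f x'] p.
    by split=> // u /hp; rewrite fE.
  move=> /(getI (P := [set x | D x /\ forall x', D x' -> f x <= f x'])).
  by move=> [h1 h2]; split=> // u /h2; rewrite fE.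
pose A := D `&` [set u | enorm (y - u) <= enorm (y - x0)].
have cA : closed A.
  apply: closedI => //.
  apply: (@preimage_closed _ _ (fun u : 'rV[R]_n => enorm (y - u)) [set x | x <= enorm (y - x0)]).
    by move=> u _; exact: enorm_continuous.
  exact: closed_le.
have bA : bounded_set A.
  exists (enorm (y - x0) + `|y|); split; first exact: num_real.
  move=> M hM u [_ /= hu]; rewrite [leLHS]/Num.norm /= mx_normrE.
  apply: bigmax_le => [|[k i] _ /=].
    by apply: le_trans (ltW hM); rewrite addr_ge0// enorm_ge0.
  apply: le_trans (ltW hM); rewrite (ord1 k).
  have -> : u 0 i = - (y - u) 0 i + y 0 i by rewrite !mxE; ring.
  apply: le_trans (ler_normD _ _) _; rewrite normrN lerD//.
    by apply: le_trans hu; exact: coord_le_enorm.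
  rewrite [leRHS]/Num.norm /= mx_normrE.
  by apply: (@le_bigmax _ _ _ _ (fun ij : 'I_1 * 'I_n => `|y ij.1 ij.2|) (0, i)).
have cpA := bounded_closed_compact bA cA.
have [||p pA hp] := @compact_EVT_min _ R (fun u : 'rV[R]_n => enorm (y - u)) A _ cpA.
- by exists x0; split=> //=.
- by apply: continuous_subspaceT; exact: enorm_continuous.
rewrite inE in pA; exists p; split; first by case: pA.
move=> u Du; have [h|h] := leP (enorm (y - u)) (enorm (y - x0)).
  by apply: hp; rewrite inE.
by case: pA => _ /= /le_trans; apply; exact: ltW.
Qed.

(** The inequality amounts to <y - p, q - p> <= 0; otherwise a short step from p towards q would
    come closer to y. *)
Lemma projection_ineq (R : realType) n (D : set 'rV[R]_n) (y p q : 'rV[R]_n) :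
  (forall u v (s : R), D u -> D v -> 0 <= s <= 1 -> D (u + s *: (v - u))) ->
  D p -> (forall u, D u -> enorm (y - p) <= enorm (y - u)) -> D q ->
  enorm (y - p) ^+ 2 + enorm (p - q) ^+ 2 <= enorm (y - q) ^+ 2.
Proof.
move=> convD Dp hp Dq; pose a := y - p; pose b := q - p.
suff : ip a b <= 0.
  have -> : y - q = a - b by rewrite /a /b opprB addrA subrK.
  have -> : enorm (p - q) ^+ 2 = ip b b.
    by rewrite enorm_sqr -(opprB q p) ipNl ipNr opprK.
  by rewrite -/a (enorm_sqr a) enorm_sqrB; lra.
rewrite leNgt; apply/negP => ab0.
have key s : 0 <= s <= 1 -> 2 * s * ip a b <= s ^+ 2 * ip b b.
  move=> s01; have := hp _ (convD _ _ _ Dp Dq s01).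
  rewrite enorm_le opprD addrA -/a -/b enorm_sqr enorm_sqrB.
  by rewrite !ipZl !ipZr; lra.
(* A step short enough that s |b|^2 < <a, b>; the added 1 keeps the denominator positive. *)
pose s := Num.min 1 (ip a b / (ip b b + 1)).
have b1 : 0 < ip b b + 1 by have := ip_ge0 b; lra.
have s0 : 0 < s by rewrite lt_min ltr01 divr_gt0.
have s1 : s <= 1 by rewrite ge_min lexx.
have : s * ip b b < ip a b.
  apply: (@lt_le_trans _ _ (s * (ip b b + 1))); first by rewrite ltr_pM2l// ltrDl.
  by rewrite -ler_pdivlMr// ge_min lexx orbT.
have := key s; rewrite s1 (ltW s0) => /(_ isT).
rewrite expr2 -mulrA -mulrA [2 * _]mulrCA ler_pM2l//.
by lra.
Qed.

Lemma concave_coneP (R : realType) n (u v : 'rV[R]_n) (s : R) :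
  concave_cone R n u -> concave_cone R n v -> 0 <= s <= 1 ->
  concave_cone R n (u + s *: (v - u)).
Proof.
move=> cu cv /andP[s0 s1] i j k ji kj; rewrite !mxE.
have h1 := ler_wpM2l s0 (cv i j k ji kj).
have s1' : 0 <= 1 - s by lra.
have h2 := ler_wpM2l s1' (cu i j k ji kj).
by lra.
Qed.

Lemma concave_cone0 (R : realType) n : concave_cone R n 0.
Proof. by move=> i j k _ _; rewrite !mxE. Qed.

Lemma concave_cone_closed (R : realType) n : closed (concave_cone R n).
Proof.
rewrite (_ : concave_cone R n = \bigcap_(x in [set x : 'I_n * 'I_n * 'I_n |
    x.1.2 = x.1.1.+1 :> nat /\ x.2 = x.1.2.+1 :> nat])
  ((fun u : 'rV[R]_n => u 0 x.1.2 + u 0 x.1.2 - u 0 x.1.1 - u 0 x.2) @^-1` [set t | 0 <= t])).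
  apply: closed_bigI => x _; apply: preimage_closed; last exact: closed_ge.
  move=> u _; have FFu : Filter (nbhs u) by exact: (@nbhs_filter 'rV[R]_n u).
  by apply: cvgB; [apply: cvgB; [apply: cvgD|]|]; exact: coord_continuous.
apply/seteqP; split => u /=.
  move=> cu [[i j] k] /= [ji kj]; have := cu i j k ji kj; lra.
by move=> h i j k ji kj; have := h (i, j, k) (conj ji kj); rewrite /=; lra.
Qed.

Lemma orth_compl_closed (R : realType) m n (A : 'M[R]_(m, n)) :
  closed [set v : 'rV[R]_n | (v <= orth_compl A)%MS].
Proof.
rewrite (_ : [set v | _] = \bigcap_(j in [set: 'I_m])
  ((fun u : 'rV[R]_n => \sum_(i < n) u 0 i * A j i) @^-1` [set 0])).
  apply: closed_bigI => j _; apply: preimage_closed; last exact: closed_eq.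
  move=> u _; have FFu : Filter (nbhs u) by exact: (@nbhs_filter 'rV[R]_n u).
  rewrite /continuous_at; elim: (index_enum 'I_n) => [|i r IH].
    by rewrite big_nil; under eq_fun do rewrite big_nil; exact: cvg_cst.
  rewrite big_cons; under eq_fun do rewrite big_cons.
  by apply: cvgD => //; apply: cvgM; [exact: coord_continuous|exact: cvg_cst].
apply/seteqP; split => u /=.
  move=> /sub_kermxP h j _ /=; have := congr1 (fun M : 'rV[R]_m => M 0 j) h.
  rewrite !mxE => h0; rewrite -[RHS]h0.
  by apply: eq_bigr => i _; rewrite mxE.
move=> h; apply/sub_kermxP/rowP => j; have h0 := h j I; rewrite /= in h0.
by rewrite !mxE -[RHS]h0; apply: eq_bigr => i _; rewrite mxE.
Qed.

Lemma lse_spec (R : realType) n (y : 'rV[R]_n) :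
  concave_cone R n (lse y) /\
  forall q, concave_cone R n q ->
    enorm (y - lse y) ^+ 2 + enorm (lse y - q) ^+ 2 <= enorm (y - q) ^+ 2.
Proof.
have [h1 h2] := @argmin_spec R n (concave_cone R n) y (fun u => enorm (y - u) ^+ 2)
  (ex_intro _ 0 (@concave_cone0 R n)) (@concave_cone_closed R n)
  (fun u v => esym (enorm_le _ _)).
split=> // q; apply: projection_ineq h1 h2.
by move=> u v s; exact: concave_coneP.
Qed.

(** The two hypotheses add up to |p - p'|^2 <= <y - y', p - p'>; expanding the square of (y - y') -
    (p - p') finishes. *)
Lemma obtuse_nonexpansive (R : realType) n (y y' p p' : 'rV[R]_n) :
  enorm (y - p) ^+ 2 + enorm (p - p') ^+ 2 <= enorm (y - p') ^+ 2 ->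
  enorm (y' - p') ^+ 2 + enorm (p' - p) ^+ 2 <= enorm (y' - p) ^+ 2 ->
  enorm (p - p') <= enorm (y - y').
Proof.
rewrite enorm_le => h1 h2.
have := sqr_ge0 (enorm ((y - y') - (p - p'))).
rewrite (enorm_sqrB (y - y')) -!enorm_sqr.
have -> : ip (y - y') (p - p') = ip y p - ip y p' - ip y' p + ip y' p'.
  by rewrite ipDl ipNl !ipDr !ipNr; ring.
have e : enorm (p' - p) ^+ 2 = enorm (p - p') ^+ 2.
  by rewrite -opprB enorm_sqr ipNl ipNr opprK -enorm_sqr.
rewrite e (enorm_sqrB y' p) (enorm_sqrB y' p') in h2.
rewrite (enorm_sqrB y p) (enorm_sqrB y p') in h1.
by lra.
Qed.

Lemma lse_nonexpansive (R : realType) n (y y' : 'rV[R]_n) :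
  enorm (lse y - lse y') <= enorm (y - y').
Proof.
have [c1 h1] := lse_spec y; have [c2 h2] := lse_spec y'.
exact: obtuse_nonexpansive (h1 _ c2) (h2 _ c1).
Qed.

(** A strict sublevel set of f is the countable union, over rational points q, of the sets where
    f(q) plus the l1 distance to q is below c. *)
Lemma measurable_lipschitz (R : realType) d (T : measurableType d) n
    (X : 'I_n -> T -> R) (f : 'rV[R]_n -> R) :
  (forall i, measurable_fun setT (X i)) ->
  (forall u v, `|f u - f v| <= \sum_(i < n) `|(u - v) 0 i|) ->
  measurable_fun setT (fun w => f (\row_i X i w)).
Proof.
move=> mX lf; apply: (measurability (@RGenInftyO.G R)) => [|_ [_] [c] -> <-].
  exact: RGenInftyO.measurableE.
rewrite setTI.
pose Q (q : 'rV[rat]_n) : 'rV[R]_n := map_mx ratr q.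
rewrite (_ : _ @^-1` _ = \bigcup_(q : 'rV[rat]_n)
  [set w | f (Q q) + \sum_(i < n) `|X i w - Q q 0 i| < c]).
  apply: countable_bigcupT_measurable; first exact: countableP.
  move=> q; rewrite -[X in measurable X]setTI.
  rewrite (_ : [set w | _] = (fun w => f (Q q) + \sum_(i < n) `|X i w - Q q 0 i|)
    @^-1` `]-oo, c[%classic); last first.
    by apply/seteqP; split => w /=; rewrite in_itv.
  apply: measurable_funD => //; apply: measurable_sum => i.
  by apply: measurableT_comp => //; exact: measurable_funB.
apply/seteqP; split => w /=; rewrite in_itv /=.
  (* Approximation by q costs n e twice, in the sum and in the Lipschitz bound, and 2 n e is below
     the gap to c. *)
  move=> fc; pose e := (c - f (\row_i X i w)) / (2 * n.+1%:R).
  have n0 : 0 < 2 * n.+1%:R :> R by rewrite mulr_gt0.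
  have e0 : 0 < e by rewrite divr_gt0// subr_gt0.
  have [q hq] : exists q : 'rV[rat]_n, forall i, `|X i w - ratr (q 0 i)| < e.
    have h i : exists q : rat, `|X i w - ratr q| < e.
      have [|q /=] := @rat_in_itvoo R (X i w - e) (X i w + e); first by lra.
      by rewrite in_itv /= => /andP[? ?]; exists q; rewrite ltr_norml; apply/andP; split; lra.
    exists (\row_i projT1 (cid (h i))) => i; rewrite mxE.
    exact: (projT2 (cid (h i))).
  exists q => //=; have S : \sum_(i < n) `|X i w - Q q 0 i| <= n%:R * e.
    rewrite mulr_natl -[X in _ *+ X](card_ord n) -sumr_const.
    by apply: ler_sum => i _; rewrite mxE ltW.
  have := lf (Q q) (\row_i X i w).
  rewrite (eq_bigr (fun i => `|X i w - Q q 0 i|)); last first.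
    by move=> i _; rewrite !mxE distrC.
  have := ler_norm (f (Q q) - f (\row_i X i w)).
  have ec : 2 * (n%:R * e) < c - f (\row_i X i w).
    have -> : c - f (\row_i X i w) = 2 * n.+1%:R * e.
      by rewrite /e mulrC divfK// gt_eqF.
    by rewrite -natr1; lra.
  by lra.
move=> [q _ /=] h.
have := lf (\row_i X i w) (Q q); rewrite (eq_bigr (fun i => `|X i w - Q q 0 i|)); last first.
  by move=> i _; rewrite !mxE.
by have := ler_norm (f (\row_i X i w) - f (Q q)); lra.
Qed.

(** The coordinates of [lse] are Lipschitz because the projection is nonexpansive. *)
Lemma measurable_loss (R : realType) d (T : measurableType d) n
    (z : 'I_n -> T -> R) (theta : 'rV[R]_n) :
  (forall i, measurable_fun setT (z i)) ->
  measurable_fun setT (fun w => enorm (lse (theta + \row_i z i w) - theta) ^+ 2).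
Proof.
move=> mz; rewrite (_ : (fun w => _) = fun w => \sum_(i < n)
  (lse (theta + \row_j z j w) 0 i - theta 0 i) ^+ 2); last first.
  by apply/funext => w; rewrite enorm_sqr; apply: eq_bigr => i _; rewrite !mxE expr2.
apply: measurable_sum => i; apply: measurable_funX; apply: measurable_funB => //.
apply: (measurable_lipschitz (f := fun u => lse (theta + u) 0 i)) => // u v.
have := coord_le_enorm (lse (theta + u) - lse (theta + v)) i.
rewrite !mxE => /le_trans; apply; apply: le_trans (lse_nonexpansive _ _) _.
apply: le_trans (enorm_le_sum _) _.
by rewrite le_eqVlt; apply/orP; left; apply/eqP/eq_bigr => j _; rewrite !mxE; congr `|_|; ring.
Qed.

(** * Loss of the least squares estimator *)

Lemma affine_seqs_second_diff (R : realType) n (u : 'rV[R]_n) (i j k : 'I_n) :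
  (u <= affine_seqs R n)%MS -> j = i.+1 :> nat -> k = j.+1 :> nat ->
  u 0 k - u 0 j = u 0 j - u 0 i.
Proof.
move=> /sub_addsmxP[[D1 D2] /= ->] ji kj.
rewrite !mxE !big_ord1 !mxE kj ji -[i.+3%:R]natr1 -[i.+2%:R]natr1 -[i.+1%:R]natr1.
by ring.
Qed.

Lemma sub_orth_proj (R : realType) n (A : 'M[R]_n) (u : 'rV[R]_n) :
  (u - u *m (1%:M - orth_proj_mx A) <= A)%MS.
Proof.
rewrite mulmxBr mulmx1 opprB addrC subrK.
by rewrite /orth_proj_mx proj_mx_sub.
Qed.

Lemma sub_le_variation (R : realType) n (u : 'rV[R]_n) (i k : 'I_n) :
  u 0 i - u 0 k <= variation u.
Proof.
have ub : has_ubound (range (u 0)).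
  exists (enorm u) => _ [j _ <-]; exact: le_trans (ler_norm _) (coord_le_enorm _ _).
have lb : has_lbound (range (u 0)).
  exists (- enorm u) => _ [j _ <-]; rewrite lerNl.
  by apply: le_trans (ler_norm _) _; rewrite normrN coord_le_enorm.
rewrite lerB//; first by apply: ub_le_sup => //; exists i.
by apply: ge_inf => //; exists k.
Qed.

(* Extension by 0 beyond the last coordinate. *)
Definition seq_of (R : realType) n (u : 'rV[R]_n) (i : nat) : R :=
  odflt 0 (omap (u 0) (insub i)).

Lemma seq_ofE (R : realType) n (u : 'rV[R]_n) (i : 'I_n) : seq_of u i = u 0 i.
Proof. by rewrite /seq_of valK. Qed.

Lemma dot_seq_of (R : realType) n (u v : 'rV[R]_n) :
  dot 0 n (seq_of u) (seq_of v) = ip u v.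
Proof. by rewrite /dot big_mkord; apply: eq_bigr => i _; rewrite !seq_ofE. Qed.

Lemma seq_of_concave (R : realType) n (u : 'rV[R]_n) :
  concave_cone R n u -> concave_upto n (seq_of u).
Proof.
move=> cu i i2; have i1 := ltnW i2; have i0 := ltnW i1.
have := cu (Ordinal i0) (Ordinal i1) (Ordinal i2) erefl erefl.
by rewrite -!seq_ofE /slope.
Qed.

Lemma concave_coneZ (R : realType) n (c : R) (u : 'rV[R]_n) : 0 <= c ->
  concave_cone R n u -> concave_cone R n (c *: u).
Proof.
move=> c0 cu i j k ji kj; rewrite !mxE -!mulrBr.
by rewrite ler_wpM2l// (cu i j k).
Qed.

Lemma concave_cone_add_affine (R : realType) n (u v : 'rV[R]_n) :
  (v <= affine_seqs R n)%MS -> concave_cone R n u -> concave_cone R n (u + v).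
Proof.
move=> va cu i j k ji kj; have := affine_seqs_second_diff va ji kj.
by rewrite !mxE; have := cu i j k ji kj; lra.
Qed.

(* The oracle inequality against beta = p + (theta - mu), where p projects mu
   onto K: since K_Lperp is contained in K, p is at least as close to mu as the
   projection onto K_Lperp. *)
Lemma lse_oracle (R : realType) n (theta zeta : 'rV[R]_n) :
  let L := affine_seqs R n in
  let K := concave_cone R n in
  let mu := theta *m (1%:M - orth_proj_mx L) in
  let K_Lperp := K `&` [set v | (v <= orth_compl L)%MS] in
  let p := eproj K mu in
  K p /\ exists2 kappa, K kappa &
  enorm (lse (theta + zeta) - theta) ^+ 2 <= enorm (eproj K_Lperp mu - mu) ^+ 2 +
    (2 * ip zeta (kappa - p) - ip (kappa - p) (kappa - p)).
Proof.
move=> L K mu K_Lperp p.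
have [Kp hp] := @argmin_spec R n K mu (fun u => enorm (mu - u))
  (ex_intro _ 0 (@concave_cone0 R n)) (@concave_cone_closed R n) (fun u v => erefl).
have K0 : K_Lperp !=set0.
  by exists 0; split; [exact: concave_cone0|rewrite /= sub0mx].
have Kc : closed K_Lperp.
  by apply: closedI; [exact: concave_cone_closed|exact: orth_compl_closed].
have [[Kq _] _] := @argmin_spec R n K_Lperp mu (fun u => enorm (mu - u)) K0 Kc
  (fun u v => erefl).
have {hp} hp := hp _ Kq; rewrite -/(eproj K mu) -/p -/(eproj K_Lperp mu) in hp Kp *.
split=> //; set q := eproj K_Lperp mu in hp *.
have aff : (theta - mu <= affine_seqs R n)%MS by exact: sub_orth_proj.
have [Kt ht] := lse_spec (theta + zeta).
have {ht} := ht _ (concave_cone_add_affine aff Kp).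
move: Kt hp; move: (lse _) => t Kt hp ht.
have affN : (- (theta - mu) <= affine_seqs R n)%MS by rewrite eqmx_opp.
(* With this choice kappa - p is the estimator minus beta = p + (theta - mu), and kappa stays in K
   because theta - mu is affine. *)
exists (t + (- (theta - mu))); first exact: concave_cone_add_affine.
rewrite enorm_le in hp.
have e1 : enorm (q - mu) ^+ 2 = enorm (mu - q) ^+ 2.
  by rewrite -opprB enorm_sqr ipNl ipNr opprK -enorm_sqr.
rewrite e1; set v := t - _ - p.
have e2 : t - (p + (theta - mu)) = v by apply/rowP => i; rewrite !mxE; ring.
rewrite e2 (enorm_sqr v) in ht.
have e3 : theta + zeta - t = zeta - (t - theta).
  by apply/rowP => i; rewrite !mxE; ring.
have e4 : theta + zeta - (p + (theta - mu)) = zeta - (p - mu).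
  by apply/rowP => i; rewrite !mxE; ring.
have e5 : v = (t - theta) - (p - mu) by apply/rowP => i; rewrite !mxE; ring.
have e6 : enorm (mu - p) ^+ 2 = ip (p - mu) (p - mu).
  by rewrite -opprB enorm_sqr ipNl ipNr opprK.
rewrite e3 e4 !enorm_sqrB -e6 in ht.
have e7 : ip zeta v = ip zeta (t - theta) - ip zeta (p - mu).
  by rewrite e5 ipDr ipNr.
by rewrite e7 (enorm_sqr (t - theta)); lra.
Qed.

(** Dividing by s gives unit variance; each exponential is then a product over the coordinates, and
    its expectation is exactly 1. *)
Lemma mixture_expectation (R : realType) n l r (m s : R) phi
    (d : measure_display) (T : measurableType d) (P : probability T R)
    (z : 'I_n -> {RV P >-> R}) :
  0 < s -> iid_centered_normal s z -> mixture n l r m phi ->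
  measurable_fun setT (fun w => phi (seq_of (s^-1 *: \row_i z i w))) /\
  (\int[P]_w (phi (seq_of (s^-1 *: \row_i z i w)))%:E <= m%:E)%E.
Proof.
move=> s0 iidz [I [c [b [c0 _ cm phiE]]]].
have s0' : s != 0 by rewrite gt_eqF.
pose F k w := \prod_(i <- index_enum 'I_n) expR (s^-1 * b k i * z i w).
have FE k w : expR (dot 0 n (seq_of (s^-1 *: \row_i z i w)) (b k) - dot 0 n (b k) (b k) / 2) =
    expR (- (dot 0 n (b k) (b k) / 2)) * F k w.
  rewrite addrC expRD; congr (_ * _); rewrite /F -expR_sum; congr expR.
  by rewrite /dot big_mkord; apply: eq_bigr => i _; rewrite seq_ofE !mxE; ring.
have mF k : measurable_fun setT (F k).
  apply: measurable_prod => i _; apply: measurableT_comp => //.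
  exact: measurable_funM.
have F0 k w : 0 <= F k w by apply: prodr_ge0 => i _; exact: expR_ge0.
have intF k : (\int[P]_w (expR (- (dot 0 n (b k) (b k) / 2)) * F k w)%:E = 1)%E.
  under eq_integral do rewrite EFinM.
  rewrite ge0_integralZl//; first last.
  - by move=> w _; rewrite lee_fin.
  - exact/measurable_EFinP.
  have := @indep_exp_moment R d T P 'I_n s z (fun i => s^-1 * b k i) s0' iidz
    (index_enum 'I_n) finset.set0 (fun=> setT) (index_enum_uniq _) (fun i _ => negbT (finset.in_set0 i))
    (fun=> measurableT).
  rewrite finset.big_set0 mule1 (_ : \bigcap_(i in _) _ = setT); last first.
    by apply/seteqP; split => // w _ i; rewrite /= finset.in_set0.
  move=> ->; rewrite -EFinM -expR_sum -expRD (_ : _ + _ = 0) ?expR0//.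
  rewrite /dot big_mkord mulr_suml; apply/eqP; rewrite addrC subr_eq0; apply/eqP/eq_bigr => i _.
  by field.
have phiwE w : phi (seq_of (s^-1 *: \row_i z i w)) =
    \sum_k c k * (expR (- (dot 0 n (b k) (b k) / 2)) * F k w).
  by rewrite phiE; apply: eq_bigr => k _; rewrite FE.
have mG k : measurable_fun setT (fun w => c k * (expR (- (dot 0 n (b k) (b k) / 2)) * F k w)).
  by do 2 apply: measurable_funM => //.
split.
  rewrite (_ : (fun w => _) = fun w => \sum_k c k * (expR (- (dot 0 n (b k) (b k) / 2)) * F k w)); last first.
    by apply/funext.
  exact: measurable_sum.
under eq_integral do rewrite phiwE -sumEFin.
rewrite ge0_integral_sum//; first last.
- by move=> k w _; rewrite lee_fin !mulr_ge0// expR_ge0.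
- by move=> k; exact/measurable_EFinP.
rewrite (eq_bigr (fun k => (c k)%:E)); first by rewrite sumEFin lee_fin.
move=> k _; under eq_integral do rewrite EFinM.
rewrite ge0_integralZl//; first by rewrite intF mule1.
- by apply/measurable_EFinP; exact: measurable_funM.
- by move=> w _; rewrite lee_fin mulr_ge0// expR_ge0.
- by rewrite lee_fin.
Qed.

(** Rescaling by 1 / sigma reduces to unit variance: [concave_mixture] is applied to zeta, kappa and
    p divided by sigma, and [lse_oracle] links the result to the loss. The function [phi] depends on
    n and G only. *)
Lemma exceedance_mixture (R : realType) : exists2 C : R, 0 < C &
  forall n G : nat, (0 < n)%N ->
  exists2 phi, mixture n 0 (1 * 2 ^ (trunc_log 2 n).+1) (1 / 2 : R) phi &
  forall (sigma w : R) (theta zeta : 'rV[R]_n),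
  let L := affine_seqs R n in
  let K := concave_cone R n in
  let mu := theta *m (1%:M - orth_proj_mx L) in
  let H := variation (eproj K mu) in
  let K_Lperp := K `&` [set v | (v <= orth_compl L)%MS] in
  0 < sigma -> 1 <= w -> w ^+ 5 = n%:R * (H / sigma + 1) ^+ 2 ->
  (forall i, `|zeta 0 i| <= G%:R * sigma) ->
  expR ((enorm (lse (theta + zeta) - theta) ^+ 2 -
         enorm (eproj K_Lperp mu - mu) ^+ 2) / (17 * sigma ^+ 2) - C * w) <=
  phi (seq_of (sigma^-1 *: zeta)).
Proof.
have [C C0 HC] := concave_mixture R.
exists C => // n G n0; have [phi mphi Hphi] := HC n G n0.
exists phi => // sigma w theta zeta L K mu H K_Lperp s0 w1 w5 zG.
have [Kp [kappa Kk]] := lse_oracle theta zeta.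
rewrite -/L -/K -/mu -/K_Lperp; set p := eproj K mu in Kp * => orc.
have si0 : 0 <= sigma^-1 by rewrite invr_ge0 ltW.
have gG (i : nat) : (i < n)%N -> `|seq_of (sigma^-1 *: zeta) i| <= G%:R.
  move=> ni; rewrite -[i]/(val (Ordinal ni)) seq_ofE mxE normrM ger0_norm//.
  by rewrite mulrC ler_pdivrMr.
have vE (i : nat) : (i < n)%N -> seq_of (sigma^-1 *: (kappa - p)) i =
    seq_of (sigma^-1 *: kappa) i - seq_of (sigma^-1 *: p) i.
  by move=> ni; rewrite -[i]/(val (Ordinal ni)) !seq_ofE !mxE; ring.
have pH (i k : nat) : (i < n)%N -> (k < n)%N ->
    seq_of (sigma^-1 *: p) i - seq_of (sigma^-1 *: p) k <= H / sigma.
  move=> ni nk; rewrite -[i]/(val (Ordinal ni)) -[k]/(val (Ordinal nk)) !seq_ofE !mxE.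
  by rewrite -mulrBr mulrC ler_pM2r ?invr_gt0// sub_le_variation.
have H0 : 0 <= H / sigma.
  apply: divr_ge0; last exact: ltW.
  by have := sub_le_variation p (Ordinal n0) (Ordinal n0); rewrite subrr.
have := Hphi _ _ _ _ _ w gG (seq_of_concave (concave_coneZ si0 Kk))
  (seq_of_concave (concave_coneZ si0 Kp)) vE pH H0 w1 w5.
apply: le_trans; rewrite ler_expR lerD2r !dot_seq_of !ipZl !ipZr.
rewrite ler_pdivrMr ?mulr_gt0 ?exprn_gt0//.
move: (ip zeta _) (ip (kappa - p) _) orc => a b orc.
rewrite (_ : _ / 17 * _ = 2 * a - b); last by field; rewrite gt_eqF.
by lra.
Qed.

(** Monotone convergence; it removes the truncation of the noise. *)
Lemma integral_le_exhaustion (R : realType) (d : measure_display)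
    (T : measurableType d) (P : {measure set T -> \bar R}) (f : T -> R)
    (A : nat -> set T) (m : R) :
  measurable_fun setT f -> (forall w, 0 <= f w) ->
  (forall G, measurable (A G)) -> nondecreasing_seq A ->
  (forall w, exists G, A G w) ->
  (forall G, \int[P]_w (f w * \1_(A G) w)%:E <= m%:E)%E ->
  (\int[P]_w (f w)%:E <= m%:E)%E.
Proof.
move=> mf f0 mA ndA cA H.
have mg G : measurable_fun setT (fun w => (f w * \1_(A G) w)%:E).
  by apply/measurable_EFinP/measurable_funM => //; exact: measurable_indic.
have g0 G w : setT w -> (0 <= (f w * \1_(A G) w)%:E)%E by rewrite lee_fin mulr_ge0.
have nd w : setT w -> {homo (fun G => (f w * \1_(A G) w)%:E) : a b / (a <= b)%N >-> (a <= b)%E}.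
  move=> _ a b ab; rewrite lee_fin ler_wpM2l// !indicE ler_nat.
  have [wa|//] := boolP (w \in A a); rewrite mem_set//.
  by have /subsetPset := ndA _ _ ab; apply; rewrite inE in wa.
have := @cvg_monotone_convergence _ T R P setT measurableT _ mg g0 nd.
rewrite (eq_integral (fun w => (f w)%:E)); last first.
  move=> w _; have [G0 AG0] := cA w.
  apply/cvg_lim => //; apply: cvg_near_cst; exists G0 => // G /= G0G.
  have /subsetPset := ndA _ _ G0G => /(_ _ AG0) AG.
  by rewrite indicE mem_set// mulr1.
move=> /(cvg_lim (@ereal_hausdorff R)) <-; apply: lime_le.
  apply: ereal_nondecreasing_is_cvgn => a b ab.
  by apply: ge0_le_integral => //; [exact: g0|move=> w _; exact: (nd w I)].
by apply: nearW => G; exact: H.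
Qed.

(** On the event that all |z i| are at most G sigma, the integrand is below a mixture that depends
    on G but whose mass 1/2 does not. Then G tends to infinity. *)
Lemma loss_exp_moment (R : realType) : exists2 C : R, 0 < C &
  forall (n : nat) (sigma w : R) (theta : 'rV[R]_n)
    (d : measure_display) (T : measurableType d) (P : probability T R)
    (z : 'I_n -> {RV P >-> R}),
  (0 < n)%N -> 0 < sigma -> iid_centered_normal sigma z ->
  let L := affine_seqs R n in
  let K := concave_cone R n in
  let mu := theta *m (1%:M - orth_proj_mx L) in
  let H := variation (eproj K mu) in
  let K_Lperp := K `&` [set v | (v <= orth_compl L)%MS] in
  1 <= w -> w ^+ 5 = n%:R * (H / sigma + 1) ^+ 2 ->
  (\int[P]_t (expR ((enorm (lse (theta + \row_i z i t) - theta) ^+ 2 -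
         enorm (eproj K_Lperp mu - mu) ^+ 2) / (17 * sigma ^+ 2) - C * w))%:E
   <= (1 / 2)%:E)%E.
Proof.
have [C C0 HC] := exceedance_mixture R.
exists C => // n sigma w theta d T P z n0 s0 iidz L K mu H K_Lperp w1 w5.
pose A G := [set t | forall i, `|z i t| <= G%:R * sigma].
have mz i : measurable_fun setT (z i) by exact: measurable_funPT.
have mA G : measurable (A G).
  rewrite (_ : A G = \bigcap_(i in [set: 'I_n])
    ((fun t => `|z i t|) @^-1` `]-oo, G%:R * sigma])).
    apply: fin_bigcap_measurable => [|i _]; first exact: finite_finset.
    rewrite -[X in measurable X]setTI.
    suff : measurable_fun setT (fun t => `|z i t|) by apply.
    by apply: measurableT_comp.
  apply/seteqP; split => t /= h; first by move=> i _; rewrite /= in_itv/=.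
  by move=> i; have := h i I; rewrite /= in_itv/=.
apply: (@integral_le_exhaustion _ _ _ _ _ A) => //.
- apply: measurableT_comp => //; apply: measurable_funB => //.
  by apply: measurable_funM => //; apply: measurable_funB => //; exact: measurable_loss.
- move=> a b ab; apply/subsetPset => t At i.
  by apply: le_trans (At i) _; rewrite ler_pM2r// ler_nat.
- move=> t; exists (Num.truncn (\sum_i `|z i t| / sigma)).+1 => i.
  rewrite -ler_pdivrMr//; apply: le_trans (ltW (truncnS_gt _)).
  by rewrite (bigD1 i)//= lerDl; apply: sumr_ge0 => j _; rewrite divr_ge0// ltW.
move=> G; have [phi mphi Hphi] := HC n G n0.
have [mphi' intphi] := mixture_expectation s0 iidz mphi.
apply: le_trans intphi; apply: ge0_le_integral => //=.
- apply/measurable_EFinP/measurable_funM; last first.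
    exact: measurable_indic.
  apply: measurableT_comp => //; apply: measurable_funB => //.
  by apply: measurable_funM => //; apply: measurable_funB => //; exact: measurable_loss.
- exact/measurable_EFinP.
move=> t _; rewrite lee_fin indicE; case: (boolP (t \in A G)) => tA; last first.
  by rewrite mulr0 (mixture_ge0 _ mphi).
rewrite mulr1; apply: Hphi => // i; rewrite mxE.
by rewrite inE in tA; exact: tA.
Qed.

(** * The rate and the theorem *)

Lemma rateE (R : realType) (n : nat) (sigma H : R) : (0 < n)%N -> 0 < sigma -> 0 <= H ->
  sigma `^ (8 / 5) * (H + sigma) `^ (2 / 5) * n%:R `^ (- (4 / 5)) =
  n%:R^-1 * sigma ^+ 2 * (n%:R `^ (1 / 5) * (H / sigma + 1) `^ (2 / 5)).
Proof.
move=> n0 s0 H0; have n0R : 0 < n%:R :> R by rewrite ltr0n.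
have s0' : sigma != 0 by rewrite gt_eqF.
have -> : H + sigma = sigma * (H / sigma + 1) by field.
have a0 : 0 <= H / sigma + 1 by rewrite addr_ge0// divr_ge0// ltW.
rewrite (powRM _ (ltW s0) a0).
have -> : sigma ^+ 2 = sigma `^ (8 / 5) * sigma `^ (2 / 5).
  rewrite -powRD; last by rewrite s0' implybT.
  by rewrite -(powR_mulrn _ (ltW s0)); congr (_ `^ _); field.
have -> : n%:R `^ (- (4 / 5)) = n%:R^-1 * n%:R `^ (1 / 5) :> R.
  rewrite -(powR_inv1 (ltW n0R)) -powRD; last by apply/implyP => _; rewrite gt_eqF.
  by congr (_ `^ _); field.
by ring.
Qed.

Lemma rate_pow5 (R : realType) (n : nat) (a : R) : 1 <= a ->
  (n%:R `^ (1 / 5) * a `^ (2 / 5)) ^+ 5 = n%:R * a ^+ 2.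
Proof.
move=> a1; have a0 : 0 <= a by lra.
rewrite exprMn -!powR_mulrn ?powR_ge0// -!powRrM.
have -> : 1 / 5 * 5 = 1 :> R by field.
have -> : 2 / 5 * 5 = 2 :> R by field.
by rewrite powRr1// powR_mulrn.
Qed.

Lemma rate_ge1 (R : realType) (n : nat) (a : R) : (0 < n)%N -> 1 <= a ->
  1 <= n%:R `^ (1 / 5) * a `^ (2 / 5).
Proof.
move=> n0 a1; apply: mulr_ege1.
  by rewrite -[leLHS](powRr0 n%:R) ler_powR ?ler1n// divr_ge0.
by rewrite -[leLHS](powRr0 a) ler_powR// divr_ge0.
Qed.

Theorem theorem4p1 (R : realType) :
  exists C : R, 0 < C /\
  forall (n : nat) (sigma : R) (theta : 'rV[R]_n)
    (d : measure_display) (T : measurableType d) (P : probability T R)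
    (z : 'I_n -> {RV P >-> R}),
  (0 < n)%N -> 0 < sigma -> iid_centered_normal sigma z ->
  let y (w : T) : 'rV[R]_n := theta + \row_(i < n) z i w in
  let L := affine_seqs R n in
  let K := concave_cone R n in
  let mu := theta *m (1%:M - orth_proj_mx L) in
  let H := variation (eproj K mu) in
  let K_Lperp := K `&` [set v | (v <= orth_compl L)%MS] in
  let loss (w : T) := n%:R^-1 * enorm (lse (y w) - theta) ^+ 2 in
  let approx := n%:R^-1 * enorm (eproj K_Lperp mu - mu) ^+ 2 in
  let rate := C * sigma `^ (8 / 5) * (H + sigma) `^ (2 / 5) * n%:R `^ (- (4 / 5)) in
  (forall x : R, 0 < x ->
     ((1 - expR (- x) - expR (- (x ^+ 2 / 16)))%:E <
      P [set w | (loss w <=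
                  approx + n%:R^-1 * sigma ^+ 2 * (2 + 17 * x) + rate)%R])%E)
  /\
  ('E_P[loss] <= (approx + rate + 2 * sigma ^+ 2 / n%:R)%:E)%E.
Proof.
have [C0 C00 HC] := loss_exp_moment R.
(* 17 [C0] w comes from the exponential moment; the extra 17 w, with w >= 1, covers the term 17/2
   that remains in part (ii). *)
exists (17 * (C0 + 1)); split; first by rewrite mulr_gt0// addr_gt0.
move=> n sigma theta d T P z n0 s0 iidz y L K mu H K_Lperp loss approx rate.
have n0R : 0 < n%:R :> R by rewrite ltr0n.
have H0 : 0 <= H.
  by have := sub_le_variation (eproj K mu) (Ordinal n0) (Ordinal n0); rewrite subrr.
have a1 : 1 <= H / sigma + 1 by rewrite lerDr divr_ge0// ltW.
pose w : R := n%:R `^ (1 / 5) * (H / sigma + 1) `^ (2 / 5).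
have w1 : 1 <= w by exact: rate_ge1.
have w5 : w ^+ 5 = n%:R * (H / sigma + 1) ^+ 2 by exact: rate_pow5.
have rateEw : rate = 17 * (C0 + 1) * (n%:R^-1 * sigma ^+ 2 * w).
  by rewrite /rate -rateE// !mulrA.
pose D t := (enorm (lse (y t) - theta) ^+ 2 - enorm (eproj K_Lperp mu - mu) ^+ 2) /
  (17 * sigma ^+ 2) - C0 * w.
have intD : (\int[P]_t (expR (D t))%:E <= (1 / 2)%:E)%E.
  exact: HC n sigma w theta d T P z n0 s0 iidz w1 w5.
have mloss : measurable_fun setT loss.
  by apply: measurable_funM => //; apply: measurable_loss => i; exact: measurable_funPT.
have mD : measurable_fun setT D.
  apply: measurable_funB => //; apply: measurable_funM => //; apply: measurable_funB => //.
  by apply: measurable_loss => i; exact: measurable_funPT.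
have loss0 t : 0 <= loss t by rewrite mulr_ge0 ?sqr_ge0// invr_ge0 ltW.
have approx0 : 0 <= approx by rewrite mulr_ge0 ?sqr_ge0// invr_ge0 ltW.
have lossE t : loss t = approx + 17 * (n%:R^-1 * sigma ^+ 2) * (D t + C0 * w).
  rewrite /loss /approx /D subrK.
  move: (enorm (lse _ - _) ^+ 2) (enorm (_ - mu) ^+ 2) => a b.
  by field; rewrite !gt_eqF.
clearbody D approx loss.
set q : R := n%:R^-1 * sigma ^+ 2 in rateEw lossE *.
have q0 : 0 < q by rewrite mulr_gt0 ?invr_gt0 ?exprn_gt0.
have mexp : measurable_fun setT (fun t => (expR (D t))%:E).
  by apply/measurable_EFinP; exact: measurableT_comp.
have e0 t : (0 <= (expR (D t))%:E)%E by rewrite lee_fin expR_ge0.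
have w0 : 0 <= w := le_trans ler01 w1.
have qw : 0 <= q * w by apply: mulr_ge0 => //; exact: ltW.
split.
  move=> x x0; pose B := [set t | x < D t].
  have mB : measurable B.
    rewrite (_ : B = D @^-1` `]x, +oo[%classic); last first.
      by apply/seteqP; split => t /=; rewrite in_itv/= andbT.
    by rewrite -[X in measurable X]setTI; exact: mD.
  (* Markov's inequality for exp D. The factor 1/2 makes the bound strictly smaller than e^(-x),
     which gives the strict inequality in part (i). *)
  have PB : (P B <= (expR (- x) / 2)%:E)%E.
    have h : ((expR x)%:E * P B <= (1 / 2)%:E)%E.
      apply: le_trans intD; rewrite -(setIT B) -integral_indic// -ge0_integralZl//.
      - apply: ge0_le_integral => //.
          by apply: emeasurable_funM => //; exact/measurable_EFinP/measurable_indic.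
        move=> t _; rewrite -EFinM lee_fin indicE.
        case: (boolP (t \in B)) => [|_]; last by rewrite mulr0 expR_ge0.
        by rewrite inE /B /= mulr1 ler_expR => /ltW.
      - exact/measurable_EFinP/measurable_indic.
    have Pfin : P B \is a fin_num by rewrite fin_num_measure.
    move: h; rewrite -(fineK Pfin) -EFinM !lee_fin => h.
    rewrite expRN mulrC ler_pdivlMr ?expR_gt0//.
    by rewrite mulrC; move: h; rewrite div1r.
  set E := [set t | _].
  have mE : measurable E.
    rewrite (_ : E = loss @^-1` `]-oo, approx + q * (2 + 17 * x) + rate]%classic); last first.
      by apply/seteqP; split => t /=; rewrite in_itv.
    by rewrite -[X in measurable X]setTI; exact: mloss.
  have BE : ~` B `<=` E.
    move=> t /negP; rewrite -leNgt => Dx; rewrite /E /= lossE rateEw -/q.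
    have : 17 * q * D t <= 17 * q * x by rewrite ler_pM2l// mulr_gt0.
    by lra.
  apply: (@lt_le_trans _ _ (P (~` B))); last first.
    by apply: le_measure => //; rewrite inE//; exact: measurableC.
  rewrite probability_setC//.
  have Pfin : P B \is a fin_num by rewrite fin_num_measure.
  move: PB; rewrite -(fineK Pfin) -EFinB lee_fin lte_fin.
  have := expR_gt0 (- x); have := expR_gt0 (- (x ^+ 2 / 16)); lra.
have aC : 0 <= approx + 17 * q * (C0 * w).
  by apply: addr_ge0 => //; apply: mulr_ge0; apply: mulr_ge0 => //; exact: ltW.
(* Part (ii) integrates the pointwise bound D <= exp D. *)
rewrite unlock; apply: (@le_trans _ _ (\int[P]_t ((approx + 17 * q * (C0 * w))%:E +
    (17 * q)%:E * (expR (D t))%:E))%E).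
  apply: ge0_le_integral => //.
  - by move=> t _; rewrite lee_fin.
  - exact/measurable_EFinP.
  - apply: emeasurable_funD => //; apply: emeasurable_funM => //.
  move=> t _; rewrite -EFinM -EFinD lee_fin lossE -/q.
  have De : D t <= expR (D t) by apply: le_trans (expR_ge1Dx _); rewrite lerDr.
  have : 17 * q * D t <= 17 * q * expR (D t) by rewrite ler_pM2l// mulr_gt0.
  by lra.
rewrite ge0_integralD//; first last.
- by apply: emeasurable_funM.
- by move=> t _; rewrite mule_ge0// lee_fin mulr_ge0// ltW.
apply: (@le_trans _ _ ((approx + 17 * q * (C0 * w))%:E + (17 * q)%:E * (1 / 2)%:E)%E).
  rewrite integral_cst//; apply: leeD.
    rewrite -[leRHS]mule1; apply: lee_wpmul2l; first by rewrite lee_fin.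
    exact: probability_le1.
  rewrite ge0_integralZl//; last by rewrite lee_fin mulr_ge0// ltW.
  by rewrite lee_pmul2l// lte_fin mulr_gt0.
rewrite -EFinM -EFinD lee_fin rateEw.
have -> : 2 * sigma ^+ 2 / n%:R = 2 * q by rewrite /q; ring.
have : q <= q * w by rewrite ler_peMr// ltW.
by lra.
Qed.
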